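(* Let $P=P_\Gamma$ be an associahedron of dimension $n\ge 3$, i.e. the graph-associahedron of the path (chain) graph $\Gamma$ on $n+1$ vertices. Then for $i>i_{\max}(\Gamma)$ one has $$\beta^{-i,2(i+1)}(P)=0.$$ Moreover, denoting by $s$ the number of special subgraphs in $\Gamma$ and writing $i_{\max}=i_{\max}(\Gamma)$, one has $$\beta^{-i_{\max},\,2(i_{\max}+1)}(P)=s.$$
   Context: Graph-associahedra: let $\Gamma$ be a simple graph on the vertex set $[n+1]=\{1,\ldots,n+1\}$. Its graphical building set $B(\Gamma)$ consists of all nonempty $S\subseteq[n+1]$ such that the induced subgraph $\Gamma_S$ is connected. The graph-associahedron is the simple polytope $P_\Gamma=\sum_{S\in B(\Gamma)}\Delta_S$ (Minkowski sum), $\Delta_S=\operatorname{conv}\{e_j:j\in S\}\subset\mathbb R^{n+1}$, with $e_1,\ldots,e_{n+1}$ the standard basis. When $\Gamma$ is connected, $P_\Gamma$ has dimension $n$ and its facets correspond bijectively to the proper elements $S\ne[n+1]$ of $B(\Gamma)$; a set of facets has nonempty intersection iff any two of the corresponding vertex sets are disjoint or nested, and whenever at least two of them are pairwise disjoint, their union induces a disconnected subgraph of $\Gamma$. The associahedron $As^n$ is $P_\Gamma$ for $\Gamma$ the path (chain) graph on $n+1$ vertices. Special subgraphs: subgraphs of $\Gamma$ are identified with their vertex sets (all are induced, and nonempty). For a connected subgraph $\gamma$ of $\Gamma$, let $i(\gamma)$ be the number of connected subgraphs $\tilde\gamma$ of $\Gamma$ such that either $\gamma\cap\tilde\gamma$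 is different from $\varnothing$, $\gamma$ and $\tilde\gamma$, or $\gamma\cap\tilde\gamma=\varnothing$ and $\gamma\sqcup\tilde\gamma$ is a connected subgraph of $\Gamma$. Let $i_{\max}(\Gamma)$ be the maximum of $i(\gamma)$ over all connected subgraphs $\gamma$ of $\Gamma$. A connected subgraph $\gamma$ on which $i_{\max}(\Gamma)$ is achieved is called a special subgraph. Bigraded Betti numbers: let $\Bbbk$ be a field or the ring of integers. For a simple polytope $P$ with facets $F_1,\ldots,F_m$, let $K_P$ be its nerve complex (simplices are the sets of indices of facets with nonempty common intersection) and $\Bbbk[K_P]=\Bbbk[v_1,\ldots,v_m]/\mathcal I$ its Stanley--Reisner ring, where $\deg v_i=2$ and $\mathcal I$ is generated by the square-free monomials corresponding to non-simplices. Then $$\beta^{-i,2j}(P)=\operatorname{rk}_{\Bbbk}\operatorname{Tor}^{-i,2j}_{\Bbbk[v_1,\ldots,v_m]}(\Bbbk[K_P],\Bbbk),$$ where $-i$ is the (negative) homological degree and $2j$ the internal degree. By Hochster's theorem, $\beta^{-i,2(i+1)}(P)=\sum_{J\subset[m],\,|J|=i+1}(\operatorname{cc}(P_J)-1)$, where $P_J=\bigcup_{j\in J}F_j$ and $\operatorname{cc}(P_J)$ is its number of connected components. *)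

(* Defs.v *)
From HB Require Import structures.
From mathcomp Require Import all_boot all_order all_algebra.
From mathcomp Require Import reals.
From mathcomp Require Import mpoly.

Set Implicit Arguments.
Unset Strict Implicit.
Unset Printing Implicit Defensive.

Import Order.TTheory GRing.Theory Num.Theory.

Local Open Scope ring_scope.

(** * Graphs and special subgraphs *)

(* A simple graph on a finite vertex set is a symmetric irreflexive relation;
   an induced subgraph is identified with its set of vertices. *)

Section Graph.
Variables (T : finType) (e : rel T).

Definition connected_subgraph (S : {set T}) : bool :=
  (S != set0) &&
  [forall x in S, forall y in S,
     connect [rel u v | [&& u \in S, v \in S & e u v]] x y].

Definition building_set : {set {set T}} := [set S | connected_subgraph S].

Definition incompatible (g h : {set T}) : bool :=
  [&& g :&: h != set0, g :&: h != g & g :&: h != h]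
  || (g :&: h == set0) && connected_subgraph (g :|: h).

Definition i_of (g : {set T}) : nat :=
  #|[set h in building_set | incompatible g h]|.

Definition i_max : nat := (\max_(g in building_set) i_of g)%N.

Definition special_subgraphs : {set {set T}} :=
  [set g in building_set | i_of g == i_max].

End Graph.

(* Vertex [j] of [1, ..., N] is represented by the ordinal [j - 1]. *)
Definition path_graph (N : nat) : rel 'I_N :=
  [rel u v : 'I_N | (u.+1 == v :> nat) || (v.+1 == u :> nat)].

(** * Polytopes in R^N *)

Section Polytope.
Variables (R : realType) (N : nat).
Implicit Types (P G : 'rV[R]_N -> Prop).

Definition simplex_of (S : {set 'I_N}) (x : 'rV[R]_N) : Prop :=
  exists t : 'I_N -> R,
    [/\ forall j, 0 <= t j,
        \sum_(j in S) t j = 1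
      & x = \sum_(j in S) t j *: delta_mx 0 j].

Definition graph_associahedron (e : rel 'I_N) (x : 'rV[R]_N) : Prop :=
  exists p : {set 'I_N} -> 'rV[R]_N,
    (forall S, S \in building_set e -> simplex_of S (p S)) /\
    x = \sum_(S in building_set e) p S.

Definition same_set P G : Prop := forall x, P x <-> G x.

(* The face of [P] on which the linear functional given by [c] is maximal. *)
Definition face_of P (c : 'rV[R]_N) (x : 'rV[R]_N) : Prop :=
  P x /\ forall y, P y -> \sum_j c 0 j * y 0 j <= \sum_j c 0 j * x 0 j.

Definition is_face P G : Prop := exists c, same_set G (face_of P c).

Definition is_proper_face P G : Prop := is_face P G /\ ~ same_set G P.

(* Facets are the inclusion-maximal proper faces. *)
Definition is_facet P G : Prop :=
  is_proper_face P G /\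
  forall G', is_proper_face P G' -> (forall x, G x -> G' x) -> same_set G G'.

(* [F] lists the facets [F_1, ..., F_m] of [P] without repetition. *)
Definition facets_of P (m : nat) (F : 'I_m -> 'rV[R]_N -> Prop) : Prop :=
  [/\ forall i, is_facet P (F i),
      forall G, is_facet P G -> exists i, same_set G (F i)
    & forall i j, same_set (F i) (F j) -> i = j].

Definition nerve (m : nat) (F : 'I_m -> 'rV[R]_N -> Prop)
    (J : {set 'I_m}) : Prop :=
  exists x, forall j, j \in J -> F j x.

End Polytope.

(** * Stanley-Reisner ideals, Tor and bigraded Betti numbers *)

Definition field_or_integers (k : idomainType) : Prop :=
  (forall x : k, x != 0 -> x \is a GRing.unit) \/
  (exists f : {rmorphism int -> k}, bijective f).

(* Membership in the ideal generated by the square-free monomials of the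
   non-simplices of [K]; the Stanley-Reisner ring k[K] is the quotient of
   k[v_1, ..., v_m] by it. *)
Definition SR_ideal (k : idomainType) (m : nat) (K : {set 'I_m} -> Prop)
    (p : {mpoly k[m]}) : Prop :=
  exists q : {set 'I_m} -> {mpoly k[m]},
    (forall J, K J -> q J = 0) /\
    p = \sum_(J : {set 'I_m}) q J * \prod_(j in J) 'X_j.

(* A graded resolution of the cyclic module A / I, where A = k[v_1, ..., v_m]
   with deg v_i = 2, by free A-modules of finite rank (one exists when k is
   Noetherian and I is homogeneous):

     ... --> A^(res_rank 2) --> A^(res_rank 1) --> A^(res_rank 0) --> A/I --> 0

   The r-th basis element of the i-th module has degree [res_deg r]. Elements
   are row vectors, and [res_diff i] acts on the right. The augmentation is
   given by a column of polynomials lifting the images in A / I of the basis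
   of the 0-th module. [res_diff_homog] and [res_aug_homog] say that all maps
   preserve degrees. *)
Record graded_free_resolution (k : idomainType) (m : nat)
    (I : {mpoly k[m]} -> Prop) := GradedFreeResolution {
  res_rank : nat -> nat;
  res_deg : forall i, 'I_(res_rank i) -> nat;
  res_diff : forall i, 'M[{mpoly k[m]}]_(res_rank i.+1, res_rank i);
  res_aug : 'cV[{mpoly k[m]}]_(res_rank 0);
  res_diff_homog : forall i r c mu, mu \in msupp (res_diff i r c) ->
    res_deg r = (res_deg c + (mdeg mu).*2)%N;
  res_aug_homog : forall r mu, mu \in msupp (res_aug r 0) ->
    res_deg r = (mdeg mu).*2;
  res_aug_surj : forall p, exists v : 'rV_(res_rank 0),
    I (p - (v *m res_aug) 0 0);
  res_exact0 : forall v : 'rV_(res_rank 0),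
    I ((v *m res_aug) 0 0) <-> exists w, v = w *m res_diff 0;
  res_exact : forall i (v : 'rV_(res_rank i.+1)),
    v *m res_diff i = 0 <-> exists w, v = w *m res_diff i.+1
}.

(* The rank of Z / B over the domain k: the largest size of a family in Z
   that is k-linearly independent modulo B. *)
Section Rank.
Variables (k : idomainType) (V : lmodType k).
Implicit Types (Z B : V -> Prop).

Definition free_modulo B (r : nat) (z : 'I_r -> V) : Prop :=
  forall a : 'I_r -> k, B (\sum_(l < r) a l *: z l) -> forall l, a l = 0.

Definition has_rank Z B (r : nat) : Prop :=
  (exists z : 'I_r -> V, (forall l, Z (z l)) /\ free_modulo B z) /\
  (forall z : 'I_r.+1 -> V, (forall l, Z (z l)) -> ~ free_modulo B z).

End Rank.

(* Tor^{-i,d}_A(A/I, k) is the degree d part of the i-th homology of the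
   complex obtained by tensoring a free resolution of A/I over A with
   k = A / (v_1, ..., v_m). That complex consists of the modules
   k^(res_rank i), and its differentials are the matrices of constant
   coefficients. *)
Section Tor.
Variables (k : idomainType) (m : nat) (I : {mpoly k[m]} -> Prop).
Variable X : graded_free_resolution I.

Definition tor_diff (i : nat) : 'M[k]_(res_rank X i.+1, res_rank X i) :=
  map_mx (mcoeff 0%MM) (res_diff X i).

Definition in_degree (i d : nat) (z : 'rV[k]_(res_rank X i)) : Prop :=
  forall c, z 0 c != 0 -> res_deg c = d.

Definition tor_cycle (i d : nat) : 'rV[k]_(res_rank X i) -> Prop :=
  match i return 'rV[k]_(res_rank X i) -> Prop with
  | 0 => fun z => in_degree d z
  | i'.+1 => fun z => in_degree d z /\ z *m tor_diff i' = 0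
  end.

Definition tor_boundary (i d : nat) (z : 'rV[k]_(res_rank X i)) : Prop :=
  exists y : 'rV[k]_(res_rank X i.+1), in_degree d y /\ z = y *m tor_diff i.

(* [bigraded_betti X i d b] states that rk Tor^{-i,d} = b. *)
Definition bigraded_betti (i d b : nat) : Prop :=
  has_rank (@tor_cycle i d) (@tor_boundary i d) b.

End Tor.

(* Main.v *)
Require Import Defs.
From mathcomp Require Import all_boot all_order all_algebra.
From mathcomp Require Import reals.
From mathcomp Require Import mpoly.
From mathcomp Require Import zify ring.

(* Tor can be computed from the given resolution X or from the Koszul complex
   of k over A = k[v_1, ..., v_m]: a zig-zag in the double complex X (x) Koszul
   identifies the rank of Tor^{-i,2(i+1)} with that of the part of the Koszul
   homology of A/I spanned by the v_j e_S with |S| = i. The latter consists of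
   the families of functions on the (i+1)-subsets J of the facets that agree on
   any two facets of J that meet, modulo the functions constant on each J; this
   is the linear strand of Hochster's formula and depends only on which pairs of
   facets meet.

   The facets are the proper intervals of the path. The interval [a, b] is the
   diagonal (a, b + 2) of a polygon with N + 2 = n + 3 vertices, and two facets
   are disjoint iff the diagonals cross. If all diagonals of J1 cross all those
   of J2, then J1 (resp. J2) is contained in the set of pairs joining its u and w
   (resp. s and t) endpoints on the two sides of a diagonal of the other family.
   No vertex is an endpoint of both families, so u + w + s + t <= N + 2, and
     u w + s t - 1 <= (u + s - 1) (w + t - 1) <= floor(N/2) ceil(N/2) <= i_max.
   Equality forces one of the families to be a single diagonal, which is then
   special, and the other one to consist of all diagonals crossing it. *)

Set Implicit Arguments.
Unset Strict Implicit.
Unset Printing Implicit Defensive.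

Import Order.TTheory GRing.Theory Num.Theory.

(** * Ranks over an integral domain *)

Section ActRank.
Local Open Scope ring_scope.
Variable k : idomainType.

(** The action of [k] is a bare function, so that one notion of rank serves rows over [k], Koszul
    chains over the polynomial ring (scalars acting as constants) and finite functions. *)
Definition act_free_modulo (V : zmodType) (act : k -> V -> V) (B : V -> Prop)
    (r : nat) (z : 'I_r -> V) :=
  forall a : 'I_r -> k, B (\sum_(l < r) act (a l) (z l)) -> forall l, a l = 0.

Definition act_has_rank (V : zmodType) (act : k -> V -> V) (Z B : V -> Prop)
    (r : nat) :=
  (exists z : 'I_r -> V, (forall l, Z (z l)) /\ act_free_modulo act B z) /\
  (forall z : 'I_r.+1 -> V, (forall l, Z (z l)) -> ~ act_free_modulo act B z).

(** Linear combinations of related families are related, and [rho] matches boundaries with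
    boundaries, so independence modulo boundaries passes both ways. A relation replaces a map
    because the lifts in a zig-zag are not unique. *)
Lemma act_has_rank_transfer (V W : zmodType) (actV : k -> V -> V)
    (actW : k -> W -> W) (Z B : V -> Prop) (Z' B' : W -> Prop)
    (rho : V -> W -> Prop) r :
  rho 0 0 ->
  (forall x y x' y', rho x y -> rho x' y' -> rho (x + x') (y + y')) ->
  (forall a x y, rho x y -> rho (actV a x) (actW a y)) ->
  (forall x, Z x -> exists y, Z' y /\ rho x y) ->
  (forall y, Z' y -> exists x, Z x /\ rho x y) ->
  (forall x y, rho x y -> B x <-> B' y) ->
  act_has_rank actW Z' B' r -> act_has_rank actV Z B r.
Proof.
move=> rho0 rhoD rhoZ totl totr BB [[w [Z'w fw]] maxw].
have lin n (x : 'I_n -> V) (y : 'I_n -> W) a : (forall l, rho (x l) (y l)) ->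
    rho (\sum_l actV (a l) (x l)) (\sum_l actW (a l) (y l)).
  by move=> xy; apply: (big_ind2 rho) => // l _; apply: rhoZ.
split.
- have [x xP] := fin_all_exists (fun l => totr _ (Z'w l)).
  exists x; split=> [l|a Ba]; first by have [] := xP l.
  by apply/fw/(BB _ _ (lin _ _ _ a (fun l => (xP l).2))).
- move=> x Zx fx; have [y yP] := fin_all_exists (fun l => totl _ (Zx l)).
  apply: (maxw y) => [l|a Ba]; first by have [] := yP l.
  by apply/fx/(BB _ _ (lin _ _ _ a (fun l => (yP l).2))).
Qed.

Lemma act_has_rank0 (V : zmodType) (act : k -> V -> V) (Z B : V -> Prop) :
  B 0 -> (forall a x, B x -> B (act a x)) ->
  (forall x, Z x -> B x) -> act_has_rank act Z B 0.
Proof.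
move=> B0 BZ ZB; split; first by exists (fun _ => 0); split=> [[]|a _ []].
move=> z Zz /(_ (fun _ => 1)) fz.
have: B (\sum_(l < 1) act 1 (z l)) by rewrite big_ord1; apply/BZ/ZB.
by move=> /fz /(_ ord0) /eqP; rewrite oner_eq0.
Qed.

Lemma fraction_clear (x : {fraction k}) :
  exists nd : k * k, nd.2 != 0 /\ x * @FracField.tofrac k nd.2 = @FracField.tofrac k nd.1.
Proof.
elim/quotW: x => x; exists (frac x); split; first exact: denom_ratioP.
unlock FracField.tofrac; rewrite -[LHS]FracField.pi_mul.
apply/eqmodP; rewrite /= FracField.equivfE /FracField.mulf.
by rewrite !numden_Ratio ?mulf_neq0 ?oner_eq0 ?denom_ratioP // !mulr1 mulrC.
Qed.

(** Over the fraction field the left kernel is nonzero for dimension reasons; multiplying a kernel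
    vector by the product of its denominators brings it back to [k]. *)
Lemma dependent_rows (s : nat) (M : 'M[k]_(s.+1, s)) :
  exists2 a : 'rV[k]_s.+1, a != 0 & a *m M = 0.
Proof.
pose f := @FracField.tofrac k.
have [v vn0 vM] : exists2 v : 'rV_s.+1, v != 0 & v *m map_mx f M = 0.
  have: kermx (map_mx f M) != 0.
    rewrite kermx_eq0 -row_leq_rank -ltnNge.
    by apply: leq_ltn_trans (rank_leq_col _) _.
  move=> /rowV0Pn [v /sub_kermxP vM vn0]; by exists v.
have /fin_all_exists [nd ndP] (j : 'I_s.+1) := fraction_clear (v 0 j).
pose D := \prod_j (nd j).2.
have D0 : D != 0 by apply/prodf_neq0 => j _; have [] := ndP j.
have /fin_all_exists [a aP] (j : 'I_s.+1) : exists a, f a = f D * v 0 j.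
  exists ((nd j).1 * \prod_(i | i != j) (nd i).2).
  have [_ e] := ndP j.
  have -> : D = (nd j).2 * \prod_(i | i != j) (nd i).2 by exact: bigD1.
  by rewrite /f !tofracM -e mulrC mulrA [LHS]mulrC mulrA.
exists (\row_j a j).
  apply: contra_neq vn0 => /rowP a0; apply/rowP=> j; rewrite mxE.
  have := a0 j; rewrite !mxE => aj0; have := aP j; rewrite aj0 /f tofrac0.
  by move=> /esym/eqP; rewrite mulf_eq0 tofrac_eq0 (negPf D0) => /eqP.
apply/rowP=> j; rewrite !mxE; apply/eqP; rewrite -tofrac_eq; apply/eqP.
rewrite raddf_sum tofrac0 /=.
have /rowP/(_ j) := vM; rewrite !mxE => vMj.
transitivity (f D * (\sum_i v 0 i * map_mx f M i j)); last by rewrite vMj mulr0.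
rewrite mulr_sumr; apply: eq_bigr => i _.
by rewrite tofracM !mxE mulrA -aP.
Qed.

Lemma act_has_rank_rV s :
  act_has_rank (V := 'rV[k]_s) *:%R (fun=> True) (fun v => v = 0) s.
Proof.
split.
  exists (fun l => delta_mx 0 l); split=> // a aP l.
  have /rowP/(_ l) := aP; rewrite mxE summxE (bigD1 l) //= big1 => [|i il].
    by rewrite !mxE !eqxx mulr1 addr0.
  by rewrite !mxE eqxx eq_sym (negPf il) mulr0.
move=> z _ fz; have [a /eqP an0 aM] := dependent_rows (\matrix_l z l).
case: an0; apply/rowP => l; rewrite mxE; apply: (fz (a 0)).
rewrite -[RHS]aM mulmx_sum_row; apply: eq_bigr => i _; by rewrite rowK.
Qed.

End ActRank.

(** * The Koszul complex *)

Section Koszul.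
Local Open Scope ring_scope.
Variables (k : idomainType) (m : nat).
Notation A := {mpoly k[m]}.

Definition kos_sign (R : comNzRingType) (j : 'I_m) (S : {set 'I_m}) : R :=
  (-1) ^+ #|[set l in S | (l < j)%N]|.

(* Elements of M (x) /\^* (A^m), M free with a basis of [r] elements, as
   families of coefficients indexed by the subsets of 'I_m. *)
Notation kosT r := {ffun {set 'I_m} -> 'rV[A]_r}.

Lemma kos_sign_sq (R : comNzRingType) j S : kos_sign R j S * kos_sign R j S = 1.
Proof. by rewrite -expr2 sqrr_sign. Qed.

Lemma kos_signU (R : comNzRingType) (j l : 'I_m) (S : {set 'I_m}) : l \notin S ->
  kos_sign R j (l |: S) = (-1) ^+ (l < j)%N * kos_sign R j S.
Proof.
move=> lS; rewrite /kos_sign -exprD; congr (_ ^+ _).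
have [lj|lj] := boolP (l < j)%N.
  have -> : [set i in l |: S | (i < j)%N] = l |: [set i in S | (i < j)%N].
    apply/setP => i; rewrite !inE andb_orl; congr (_ || _).
    by case: eqP => // ->.
  by rewrite cardsU1 !inE (negPf lS).
apply: eq_card => i; rewrite !inE andb_orl.
by case: eqP => // ->; rewrite (negPf lj) (negPf lS).
Qed.

Lemma kos_sign_swap (R : comNzRingType) (j l : 'I_m) (S : {set 'I_m}) :
  j \notin S -> l \notin S -> j != l ->
  kos_sign R j S * kos_sign R l (j |: S) = - (kos_sign R l S * kos_sign R j (l |: S)).
Proof.
move=> jS lS jl; rewrite !kos_signU //.
have -> : (j < l)%N = ~~ (l < j)%N by rewrite -leqNgt ltn_neqAle jl.
move: (kos_sign R j S) (kos_sign R l S) => a b.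
by case: (l < j)%N; rewrite /= expr0 expr1; ring.
Qed.

(** The Koszul differential, sending e_T to the signed sum of v_j e_(T - j) over j in T, written by
    coefficients: the one at e_S collects the contributions of all T = S + j. *)
Definition kos (r : nat) (x : kosT r) : kosT r :=
  [ffun S : {set 'I_m} =>
     \sum_(j | j \notin S) (kos_sign A j S * 'X_j) *: x (j |: S)].

Definition rmul (r r' : nat) (x : kosT r) (M : 'M[A]_(r, r')) : kosT r' :=
  [ffun S : {set 'I_m} => x S *m M].

Lemma kosD r (x y : kosT r) : kos (x + y) = kos x + kos y.
Proof.
apply/ffunP => S; rewrite !ffunE -big_split /=; apply: eq_bigr => j _.
by rewrite ffunE scalerDr.
Qed.

Lemma kosZ r c (x : kosT r) : kos (c *: x) = c *: kos x.
Proof.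
apply/ffunP => S; rewrite !ffunE scaler_sumr; apply: eq_bigr => j _.
by rewrite ffunE !scalerA mulrC.
Qed.

Lemma kosB r (x y : kosT r) : kos (x - y) = kos x - kos y.
Proof. by rewrite -scaleN1r kosD kosZ scaleN1r. Qed.

Lemma kos_rmul r r' (x : kosT r) (M : 'M[A]_(r, r')) :
  kos (rmul x M) = rmul (kos x) M.
Proof.
apply/ffunP => S; rewrite !ffunE mulmx_suml; apply: eq_bigr => j _.
by rewrite ffunE scalemxAl.
Qed.

Lemma rmulD r r' (x y : kosT r) (M : 'M[A]_(r, r')) :
  rmul (x + y) M = rmul x M + rmul y M.
Proof. by apply/ffunP => S; rewrite !ffunE mulmxDl. Qed.

Lemma rmulZ r r' c (x : kosT r) (M : 'M[A]_(r, r')) :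
  rmul (c *: x) M = c *: rmul x M.
Proof. by apply/ffunP => S; rewrite !ffunE scalemxAl. Qed.

Lemma rmulB r r' (x y : kosT r) (M : 'M[A]_(r, r')) :
  rmul (x - y) M = rmul x M - rmul y M.
Proof. by rewrite -scaleN1r rmulD rmulZ scaleN1r. Qed.

Lemma rmulA r r' r'' (x : kosT r) (M : 'M[A]_(r, r')) (M' : 'M[A]_(r', r'')) :
  rmul (rmul x M) M' = rmul x (M *m M').
Proof. by apply/ffunP => S; rewrite !ffunE mulmxA. Qed.

(** The terms (j, l) and (l, j) are grouped in pairs. [P] is vanishing in [kos_kos] and membership
    in the Stanley-Reisner ideal in [strand_of_cycle]. *)
Lemma antisymmetric_sum (V : zmodType) (P : V -> Prop) (Q : pred 'I_m)
    (a : 'I_m -> 'I_m -> V) :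
  P 0 -> (forall x y, P x -> P y -> P (x + y)) ->
  (forall j l : 'I_m, (j < l)%N -> Q j -> Q l -> P (a j l + a l j)) ->
  P (\sum_(j | Q j) \sum_(l | Q l && (l != j)) a j l).
Proof.
move=> P0 PD Pa.
have -> : \sum_(j | Q j) \sum_(l | Q l && (l != j)) a j l =
   \sum_(j | Q j) \sum_(l | Q l && (j < l)%N) (a j l + a l j).
  transitivity (\sum_(j | Q j) (\sum_(l | Q l && (j < l)%N) a j l +
      \sum_(l | Q l && (l < j)%N) a j l)).
    apply: eq_bigr => j _; rewrite (bigID (fun l : 'I_m => (j < l)%N)) /=.
    congr (_ + _); apply: eq_bigl => l; case: (Q l) => //=;
      rewrite -?val_eqE /=; lia.
  rewrite big_split /= [X in _ + X](exchange_big_dep Q) /=; last first.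
    by move=> i j _ /andP[].
  rewrite -big_split /=; apply: eq_bigr => j Qj; rewrite big_split /=.
  by congr (_ + _); apply: eq_bigl => l; rewrite Qj.
apply: (big_ind P) => // j Qj; apply: (big_ind P) => // l /andP[Ql jl].
exact: Pa.
Qed.

Lemma kos_kosE r (x : kosT r) S :
  kos (kos x) S = \sum_(j | j \notin S) \sum_(l | (l \notin S) && (l != j))
    (kos_sign A j S * kos_sign A l (j |: S) * ('X_j * 'X_l)) *: x (l |: (j |: S)).
Proof.
rewrite ffunE; apply: eq_bigr => j jS; rewrite ffunE scaler_sumr.
apply: eq_big => [l|l _]; first by rewrite !inE negb_or andbC.
by rewrite scalerA mulrACA.
Qed.

Lemma kos_kos r (x : kosT r) : kos (kos x) = 0.
Proof.
apply/ffunP => S; rewrite kos_kosE ffunE.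
apply: (@antisymmetric_sum _ (fun v => v = 0)) => // [u v -> ->|j l jl jS lS].
  by rewrite addr0.
have jnl : j != l by rewrite neq_ltn jl.
rewrite setUCA ['X_l * _]mulrC -scalerDl -mulrDl.
by rewrite kos_sign_swap // addNr mul0r scale0r.
Qed.

(** The smallest vertex in the support of the multidegree of v^mu e_S. The Koszul differential
    preserves the multidegree, hence this vertex. *)
Definition supp_min (S : {set 'I_m}) (mu : 'X_{1..m}) : option 'I_m :=
  [pick j | ((j \in S) || (mu j != 0%N)) &&
     [forall l, ((l \in S) || (mu l != 0%N)) ==> (j <= l)%N]].

Lemma supp_minP (S : {set 'I_m}) (mu : 'X_{1..m}) (j : 'I_m) :
  (j \in S) || (mu j != 0%N) ->
  (forall l, (l \in S) || (mu l != 0%N) -> (j <= l)%N) -> supp_min S mu = Some j.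
Proof.
move=> js jm; rewrite /supp_min; case: pickP => [i /andP[iS /forallP im]|].
  by congr Some; apply/eqP; rewrite -val_eqE /= eqn_leq jm //= (implyP (im j)).
move=> /(_ j); rewrite js /= => /negP/negP/forallPn[l].
by rewrite negb_imply => /andP[/jm ->].
Qed.

Lemma supp_min_ex (S : {set 'I_m}) (mu : 'X_{1..m}) : (S != set0) || (mu != 0%MM) ->
  exists2 j : 'I_m, (j \in S) || (mu j != 0%N) &
  (forall l, (l \in S) || (mu l != 0%N) -> (j <= l)%N).
Proof.
move=> Sm.
have [j0 j0P] : exists j0, (j0 \in S) || (mu j0 != 0%N).
  case/orP: Sm => [/set0Pn[j jS]|mu0]; first by exists j; rewrite jS.
  apply/existsP; apply: contraNT mu0; rewrite negb_exists => /forallP h.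
  apply/eqP/mnmP => j; have := h j; rewrite negb_or mnm0E negbK.
  by case/andP => _ /eqP.
case: (arg_minnP (P := fun j => (j \in S) || (mu j != 0%N))
  (fun j : 'I_m => j : nat) j0P) => j jP jm.
by exists j.
Qed.

(* Contracting homotopy: multidegree by multidegree the Koszul complex is the
   augmented chain complex of a simplex, coned off from its smallest vertex. *)
Definition cone_coef (f : {set 'I_m} -> A) (S : {set 'I_m}) (mu : 'X_{1..m}) : k :=
  if supp_min S mu is Some j then
    if j \in S then (f (S :\ j))@_(mu + U_(j)) else 0
  else 0.

(** The polynomial with coefficients [cone_coef]. The test [mu j != 0] is there because subtraction
    of exponents truncates at zero. *)
Definition cone (f : {set 'I_m} -> A) (S : {set 'I_m}) : A :=
  \sum_(j in S) \sum_(mu <- msupp (f (S :\ j)) |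
       (mu j != 0%N) && (supp_min S (mu - U_(j)) == Some j))
     (f (S :\ j))@_mu *: 'X_[mu - U_(j)].

Lemma coneE f S mu : (cone f S)@_mu = cone_coef f S mu.
Proof.
rewrite /cone /cone_coef raddf_sum /=.
under eq_bigr => j _ do rewrite raddf_sum /=.
have E j : j \in S ->
  \sum_(nu <- msupp (f (S :\ j)) |
       (nu j != 0%N) && (supp_min S (nu - U_(j)) == Some j))
     ((f (S :\ j))@_nu *: 'X_[nu - U_(j)])@_mu =
  if supp_min S mu == Some j then (f (S :\ j))@_(mu + U_(j)) else 0.
  move=> jS.
  have key (nu : 'X_{1..m}) : (nu j != 0%N) ->
      (nu - U_(j) == mu)%MM = (nu == mu + U_(j))%MM.
    move=> nj; apply/eqP/eqP => [<-|->]; last by rewrite addmK.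
    by rewrite submK // lep1mP.
  transitivity (\sum_(nu <- msupp (f (S :\ j)) | nu == (mu + U_(j))%MM)
     if supp_min S mu == Some j then (f (S :\ j))@_nu else 0).
    rewrite big_mkcond [RHS]big_mkcond; apply: eq_bigr => nu _ /=.
    rewrite mcoeffZ mcoeffX.
    have [nj|nj] := boolP (nu j != 0%N) => /=.
      rewrite key //; case: (eqVneq nu (mu + U_(j))%MM) => [->|_].
        by rewrite addmK mulr1.
      by rewrite mulr0 if_same.
    rewrite negbK in nj; case: (eqVneq nu (mu + U_(j))%MM) => // e.
    by move: nj; rewrite e mnmDE mnm1E eqxx addn1.
  rewrite -big_filter; case: (boolP ((mu + U_(j))%MM \in msupp (f (S :\ j)))) => h.
    rewrite (bigD1_seq (mu + U_(j))%MM) /=; first last.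
    - exact/filter_uniq/msupp_uniq.
    - by rewrite mem_filter eqxx.
    rewrite big_filter_cond big_pred0 ?addr0 // => nu; by rewrite andbN.
  rewrite big1_seq ?memN_msupp_eq0 ?if_same // => nu.
  by rewrite mem_filter => /andP[_ /andP[/eqP -> nin]]; rewrite nin in h.
rewrite (eq_bigr _ E).
case: (supp_min S mu) => [j|]; last by rewrite big1.
case: ifP => jS; last first.
  apply: big1 => l lS; case: eqP => // - [jl]; by rewrite jl lS in jS.
rewrite (bigD1 j) //= eqxx big1 ?addr0 // => l /andP[_ lj].
by case: eqP => // - [jl]; rewrite jl eqxx in lj.
Qed.

Lemma mcoeffM_X (p : A) j (mu : 'X_{1..m}) :
  (p * 'X_j)@_mu = if mu j != 0%N then p@_(mu - U_(j)) else 0.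
Proof.
case: ifPn => [muj|muj].
  rewrite -{1}(@submK _ U_(j)%MM mu) ?lep1mP // [(_ - _ + _)%MM]addmC.
  exact: mcoeffMX.
apply/eqP; rewrite mcoeff_eq0; apply: contra muj => /msuppM_le/allpairsP.
case=> -[a b] /= []; rewrite msuppX inE => _ /eqP -> ->.
by rewrite mnmDE mnm1E eqxx addn1.
Qed.

Lemma kos_signC j S : kos_sign A j S = (kos_sign k j S)%:MP.
Proof. by rewrite /kos_sign rmorphXn rmorphN1. Qed.

Lemma mcoeff_kos r (x : kosT r) S c mu :
  (kos x S 0 c)@_mu = \sum_(j | (j \notin S) && (mu j != 0%N))
    kos_sign k j S * (x (j |: S) 0 c)@_(mu - U_(j)).
Proof.
rewrite ffunE summxE raddf_sum [RHS]big_mkcondr; apply: eq_bigr => j _ /=.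
rewrite mxE kos_signC -mulrA mcoeffCM ['X_j * _]mulrC mcoeffM_X.
by case: ifP => //; rewrite mulr0.
Qed.

(** The Koszul complex is a resolution of [k]: the constant term at the empty set is the only
    obstruction, and [cone] provides the preimage. Coefficients are compared according to whether
    the smallest vertex j0 lies in S. *)
Lemma kos_exact r (x : kosT r) : kos x = 0 ->
  (forall c, (x set0 0 c)@_0 = 0) -> exists w : kosT r, x = kos w.
Proof.
move=> Kx x0; exists [ffun S => \row_c cone (fun T => x T 0 c) S].
apply/ffunP => S; apply/rowP => c; apply/mpolyP => mu; rewrite mcoeff_kos.
under eq_bigr => j _ do rewrite ffunE mxE coneE /cone_coef.
have [/andP[/eqP -> /eqP ->]|] := boolP ((S == set0) && (mu == 0%MM)).
  by rewrite x0 big1 // => j; rewrite mnm0E eqxx andbF.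
rewrite negb_and => /supp_min_ex[j0 j0S j0m].
(* No element of S precedes j0, so the sign attached to j0 is +1. *)
have sgn0 (T : {set 'I_m}) : T \subset S -> #|[set l in T | (l < j0)%N]| = 0%N.
  move=> TS; apply: eq_card0 => l; rewrite !inE.
  apply/negbTE; rewrite negb_and -leqNgt.
  by have [/(subsetP TS) lS|//] := boolP (l \in T); rewrite j0m ?lS.
have E (j : 'I_m) : (j \notin S) && (mu j != 0%N) ->
    supp_min (j |: S) (mu - U_(j)) = Some j0.
  move=> /andP[jS muj]; apply: supp_minP => [|l].
    rewrite !inE mnmBE mnm1E; have [//|j0j] := eqVneq j0 j => /=.
    by rewrite subn0.
  rewrite !inE mnmBE mnm1E; have [->|lj] := eqVneq l j => /= [_|].
    by rewrite j0m ?muj ?orbT.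
  by rewrite subn0 => /j0m.
under eq_bigr => j jS do rewrite E //.
have [j0inS|j0S'] := boolP (j0 \in S).
(* The cycle condition at S - j0 with exponent mu + U_j0 writes the coefficient of x at S as minus
   the sum of the other terms, which are those of the cone. *)
- have := congr1 (fun y : kosT r => (y (S :\ j0) 0 c)@_(mu + U_(j0))) Kx.
  rewrite mcoeff_kos ffunE mxE mcoeff0 (bigD1 j0) /=; last first.
    by rewrite !inE eqxx mnmDE mnm1E eqxx addn1.
  rewrite /kos_sign sgn0 ?subD1set // expr0 mul1r setD1K // addmK.
  move/eqP; rewrite addr_eq0 => /eqP ->; rewrite -sumrN.
  have cnd j : [&& (j \notin S :\ j0), ((mu + U_(j0))%MM j != 0%N) & j != j0] =
      (j \notin S) && (mu j != 0%N).
    rewrite !inE mnmDE mnm1E; have [->|jj0] := eqVneq j j0.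
      by rewrite j0inS !andbF.
    by rewrite addn0 andbT.
  apply: eq_big => [j|j]; first by rewrite -andbA cnd.
  rewrite -andbA cnd => /andP[jS muj].
  have jj0 : j != j0 by apply: contraNneq jS => ->.
  have lt0 : (j0 < j)%N.
    by rewrite ltn_neqAle j0m ?muj ?orbT // eq_sym jj0.
  rewrite !inE j0inS orbT.
  (* As j0 < j, the presence of j0 changes the sign of j once, which absorbs the minus. *)
  have -> : #|[set l in S | (l < j)%N]| = #|[set l in S :\ j0 | (l < j)%N]|.+1.
    rewrite (cardsD1 j0) !inE j0inS lt0 add1n; congr _.+1; apply: eq_card => l.
    by rewrite !inE andbA.
  rewrite exprS mulN1r mulNr; congr (- (_ * (x _ 0 c)@__)).
    apply/mnmP => l; rewrite !(mnmDE, mnmBE, mnm1E); move: muj.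
    have [->|_] := eqVneq j l => /=; lia.
  apply/setP => l; rewrite !inE; have [->|//] := eqVneq l j.
  by rewrite jj0.
(* Only the term j = j0 survives: for any other j the set S + j misses j0, and the cone is zero
   there. *)
- have muj0 : mu j0 != 0%N by move: j0S; rewrite (negPf j0S').
  rewrite (bigD1 j0) ?j0S' //= setU11 /kos_sign sgn0 // expr0 mul1r.
  rewrite big1 => [|j /andP[_ jj0]]; last first.
    by rewrite !inE eq_sym (negPf jj0) (negPf j0S') mulr0.
  by rewrite addr0 submK ?lep1mP // setU1K.
Qed.

End Koszul.

(** * Bidegrees of Koszul chains *)

Section Homogeneity.
Local Open Scope ring_scope.
Variables (k : idomainType) (m : nat).
Notation A := {mpoly k[m]}.
Notation kosT r := {ffun {set 'I_m} -> 'rV[A]_r}.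

(** For [b = true] all terms have exterior degree q and internal degree d, each e_j having degree 2;
    for [b = false] no term has this bidegree. One set of stability lemmas thus serves both parts of
    a splitting. *)
Definition has_bidegree (b : bool) (q d r : nat) (wt : 'I_r -> nat)
    (x : kosT r) : Prop :=
  forall S c mu, mu \in msupp (x S 0 c) ->
    ((#|S| == q) && (wt c + (mdeg mu + #|S|).*2 == d)%N) = b.

Notation bihom := (has_bidegree true).

Lemma has_bidegree0 b q d r (wt : 'I_r -> nat) : has_bidegree b q d wt 0.
Proof. by move=> S c mu; rewrite ffunE mxE mcoeff_msupp mcoeff0 eqxx. Qed.

Lemma has_bidegreeD b q d r (wt : 'I_r -> nat) x y :
  has_bidegree b q d wt x -> has_bidegree b q d wt y ->
  has_bidegree b q d wt (x + y).
Proof.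
move=> hx hy S c mu; rewrite ffunE mxE => /msuppD_le.
by rewrite mem_cat => /orP[/hx|/hy].
Qed.

Lemma has_bidegreeN b q d r (wt : 'I_r -> nat) x :
  has_bidegree b q d wt x -> has_bidegree b q d wt (- x).
Proof.
move=> hx S c mu; rewrite ffunE mxE (perm_mem (msuppN _)); exact: hx.
Qed.

Lemma has_bidegreeB b q d r (wt : 'I_r -> nat) x y :
  has_bidegree b q d wt x -> has_bidegree b q d wt y ->
  has_bidegree b q d wt (x - y).
Proof. by move=> hx hy; apply/has_bidegreeD/has_bidegreeN. Qed.

Lemma has_bidegreeZ b q d r (wt : 'I_r -> nat) (a : k) x :
  has_bidegree b q d wt x -> has_bidegree b q d wt (a%:MP *: x).
Proof.
move=> hx S c mu; rewrite ffunE mxE mul_mpolyC => /msuppZ_le; exact: hx.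
Qed.

Lemma msupp_sumP (J : finType) (P : pred J) (f : J -> A) mu :
  mu \in msupp (\sum_(j | P j) f j) -> exists2 j, P j & mu \in msupp (f j).
Proof.
move=> h; apply/exists_inP; apply: contraLR h; rewrite negb_exists_in.
move=> /forall_inP h; rewrite mcoeff_msupp negbK raddf_sum big1 //= => j /h.
by rewrite mcoeff_msupp negbK => /eqP.
Qed.

Lemma has_bidegree_rmul b q d r r' (wt : 'I_r -> nat) (wt' : 'I_r' -> nat) x
    (M : 'M[A]_(r, r')) :
  (forall i j mu, mu \in msupp (M i j) -> wt i = (wt' j + (mdeg mu).*2)%N) ->
  has_bidegree b q d wt x -> has_bidegree b q d wt' (rmul x M).
Proof.
move=> hM hx S c mu; rewrite ffunE mxE => /msupp_sumP[i _].
move=> /msuppM_le/allpairsP[[a e] /= [ax eM ->]].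
rewrite -(hx _ _ _ ax) (hM _ _ _ eM) mdegD.
congr (_ && (_ == _)).
move: (mdeg a) (mdeg e) #|S| (wt' c) => u v s t; rewrite -!muln2; lia.
Qed.

Lemma has_bidegree_kos b q d r (wt : 'I_r -> nat) x :
  has_bidegree b q.+1 d wt x -> has_bidegree b q d wt (kos x).
Proof.
move=> hx S c mu; rewrite ffunE summxE => /msupp_sumP[j jS].
rewrite mxE kos_signC -mulrA mul_mpolyC => /msuppZ_le/msuppM_le/allpairsP[[a e] /= []].
rewrite msuppX inE => /eqP -> ex ->.
rewrite -(hx _ _ _ ex) mdegD mdeg1 cardsU1 jS.
congr (_ && (_ == _)); move: (mdeg e) #|S| (wt c) => u s t; rewrite -!muln2; lia.
Qed.

Lemma bihom_split q d r (wt : 'I_r -> nat) w : exists w1 w2,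
  [/\ w = w1 + w2, bihom q d wt w1 & has_bidegree false q d wt w2].
Proof.
pose P (S : {set 'I_m}) c mu :=
  (#|S| == q) && (wt c + (@mdeg m mu + #|S|).*2 == d)%N.
pose f b : kosT r := [ffun S : {set 'I_m} => \row_c
  \sum_(mu <- msupp (w S 0 c) | P S c mu == b) (w S 0 c)@_mu *: 'X_[mu]].
exists (f true), (f false).
have hf b : has_bidegree b q d wt (f b).
  move=> S c mu; rewrite ffunE mxE => h; apply/eqP; apply: contraLR h => h.
  rewrite mcoeff_msupp negbK raddf_sum big1 // => nu /= Pnu.
  rewrite mcoeffZ mcoeffX; case: eqP => [e|]; last by rewrite mulr0.
  by move: h; rewrite -e -[_ == b]/(P S c nu == b) Pnu.
split=> //; apply/ffunP => S; apply/rowP => c; rewrite !ffunE !mxE.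
rewrite {1}(mpolyE (w S 0 c)) (bigID (P S c)) /=.
by congr (_ + _); apply: eq_bigl => mu; case: (P S c mu).
Qed.

Lemma has_bidegree_absurd q d r (wt : 'I_r -> nat) x :
  bihom q d wt x -> has_bidegree false q d wt x -> x = 0.
Proof.
move=> ht hf; apply/ffunP => S; apply/rowP => c; apply/mpolyP => mu.
rewrite ffunE mxE mcoeff0; apply/eqP; rewrite mcoeff_eq0; apply/negP => h.
by have := ht _ _ _ h; rewrite hf.
Qed.

(** Both u and v are cut down to their parts of the right bidegree. The resulting error lies in that
    bidegree and also has no term in it, so it vanishes. *)
Lemma bihom_lift q d r r' (wt : 'I_r -> nat) (wt' : 'I_r' -> nat)
    (M : 'M[A]_(r, r')) x u v :
  (forall i j mu, mu \in msupp (M i j) -> wt i = (wt' j + (mdeg mu).*2)%N) ->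
  bihom q d wt' x -> x = rmul u M + kos v ->
  exists u' v', [/\ bihom q d wt u', bihom q.+1 d wt' v' & x = rmul u' M + kos v'].
Proof.
move=> hM hx xE.
have [u1 [u2 [uE u1t u2f]]] := bihom_split q d wt u.
have [v1 [v2 [vE v1t v2f]]] := bihom_split q.+1 d wt' v.
exists u1, v1; split=> //; apply/eqP; rewrite -subr_eq0; apply/eqP.
have E : x - (rmul u1 M + kos v1) = rmul u2 M + kos v2.
  by rewrite xE uE vE rmulD kosD addrACA [LHS]addrC addKr.
apply: (@has_bidegree_absurd q d _ wt').
  apply: has_bidegreeB => //; apply: has_bidegreeD; last exact: has_bidegree_kos.
  exact: has_bidegree_rmul hM _.
rewrite E; apply: has_bidegreeD; last exact: has_bidegree_kos.
exact: has_bidegree_rmul hM _.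
Qed.

Lemma bihom_lift_kos q d r (wt : 'I_r -> nat) (x v : kosT r) :
  bihom q d wt x -> x = kos v -> exists2 v', bihom q.+1 d wt v' & x = kos v'.
Proof.
move=> hx xE.
have [v1 [v2 [vE v1t v2f]]] := bihom_split q.+1 d wt v.
exists v1 => //; apply/eqP; rewrite -subr_eq0; apply/eqP.
have E : x - kos v1 = kos v2 by rewrite xE vE kosD addrC addKr.
apply: (@has_bidegree_absurd q d _ wt).
  by apply: has_bidegreeB => //; exact: has_bidegree_kos.
by rewrite E; exact: has_bidegree_kos.
Qed.

Lemma bihom_lift_rmul q d r r' (wt : 'I_r -> nat) (wt' : 'I_r' -> nat)
    (M : 'M[A]_(r, r')) x u :
  (forall i j mu, mu \in msupp (M i j) -> wt i = (wt' j + (mdeg mu).*2)%N) ->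
  bihom q d wt' x -> x = rmul u M -> exists2 u', bihom q d wt u' & x = rmul u' M.
Proof.
move=> hM hx xE.
have [u1 [u2 [uE u1t u2f]]] := bihom_split q d wt u.
exists u1 => //; apply/eqP; rewrite -subr_eq0; apply/eqP.
have E : x - rmul u1 M = rmul u2 M by rewrite xE uE rmulD addrC addKr.
apply: (@has_bidegree_absurd q d _ wt').
  by apply: has_bidegreeB => //; exact: has_bidegree_rmul hM _.
by rewrite E; exact: has_bidegree_rmul hM _.
Qed.

Lemma bihom_set0 q d r (wt : 'I_r -> nat) x c mu :
  bihom q.+1 d wt x -> (x set0 0 c)@_mu = 0.
Proof.
move=> hx; apply/eqP; rewrite mcoeff_eq0; apply/negP => /hx.
by rewrite cards0.
Qed.

End Homogeneity.

(** * Stanley-Reisner ideals and Tor *)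

Section StanleyReisner.
Local Open Scope ring_scope.
Variables (k : idomainType) (m : nat) (K : {set 'I_m} -> Prop).
Notation A := {mpoly k[m]}.
Notation I := (@SR_ideal k m K).

Lemma msupp_prodX (p : A) (J : {set 'I_m}) mu :
  mu \in msupp (p * \prod_(j in J) 'X_j) -> forall j, j \in J -> mu j != 0%N.
Proof.
have -> : \prod_(j in J) 'X_j = 'X_[(\sum_(j in J) U_(j))%MM] :> A.
  by rewrite (big_morph _ (@mpolyXD m k) (mpolyX0 m k)).
rewrite (perm_mem (msuppMX _ _)) => /mapP[nu _ ->] j jJ.
by rewrite mnmDE mnm_sumE (bigD1 j) //= mnm1E eqxx addnC addnS.
Qed.

Lemma SR_msupp (p : A) mu : I p -> mu \in msupp p ->
  exists J : {set 'I_m}, ~ K J /\ (forall j, j \in J -> mu j != 0%N).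
Proof.
move=> [q [qK ->]] /msupp_sumP[J _ muJ]; exists J; split.
  by move=> /qK q0; move: muJ; rewrite q0 mul0r mcoeff_msupp mcoeff0 eqxx.
exact: msupp_prodX muJ.
Qed.

Lemma SR0 : I 0.
Proof. by exists (fun _ => 0); split=> //; rewrite big1 // => J; rewrite mul0r. Qed.

Lemma SRD (p p' : A) : I p -> I p' -> I (p + p').
Proof.
move=> [q [qK ->]] [q' [qK' ->]]; exists (fun J => q J + q' J); split.
  by move=> J KJ; rewrite qK // qK' // addr0.
by rewrite -big_split; apply: eq_bigr => J _; rewrite mulrDl.
Qed.

Lemma SRM (a p : A) : I p -> I (a * p).
Proof.
move=> [q [qK ->]]; exists (fun J => a * q J); split.
  by move=> J KJ; rewrite qK // mulr0.
by rewrite mulr_sumr; apply: eq_bigr => J _; rewrite mulrA.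
Qed.

Lemma SRN (p : A) : I p -> I (- p).
Proof. by rewrite -mulN1r; exact: SRM. Qed.

Lemma SRB (p p' : A) : I p -> I p' -> I (p - p').
Proof. by move=> h /SRN; exact: SRD. Qed.

Lemma SR_sum (T : finType) (P : pred T) (f : T -> A) :
  (forall j, P j -> I (f j)) -> I (\sum_(j | P j) f j).
Proof. by move=> h; apply: (big_ind I); [exact: SR0 | exact: SRD|]. Qed.

Lemma SR_X (i j : 'I_m) : i != j -> ~ K [set i; j] -> I ('X_i * 'X_j).
Proof.
move=> ij nK; exists (fun J => if J == [set i; j] then 1 else 0); split.
  by move=> J KJ; case: eqP => // e; rewrite e in KJ.
rewrite (bigD1 [set i; j]) //= eqxx mul1r [X in _ + X]big1 => [|J /negPf ->].
  by rewrite addr0 big_setU1 ?inE ?big_set1.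
by rewrite mul0r.
Qed.

(** Each term of p is divisible by the monomial of a non-simplex. With [SR_msupp], membership
    becomes a condition on each monomial separately. *)
Lemma SR_mem (p : A) : (forall mu, mu \in msupp p ->
  exists J : {set 'I_m}, ~ K J /\ (forall j, j \in J -> mu j != 0%N)) -> I p.
Proof.
move=> h; rewrite (mpolyE p) big_seq_cond.
apply: (big_ind I); [exact: SR0 | exact: SRD |] => mu.
rewrite andbT => /h[J [nKJ muJ]].
pose e := (\sum_(j in J) U_(j))%MM : 'X_{1..m}.
have emu : (e <= mu)%MM.
  apply/mnm_lepP => j; rewrite /e mnm_sumE.
  under eq_bigr => l _ do rewrite mnm1E.
  rewrite -big_mkcondr sum1_card; have [jJ|jJ] := boolP (j \in J).
    rewrite (leq_trans _ (_ : 0 < mu j)%N) ?lt0n ?muJ // -(cards1 j).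
    apply/subset_leq_card/subsetP => l.
    by rewrite unfold_in inE => /andP[_].
  rewrite eq_card0 // => l; rewrite unfold_in; apply/negbTE.
  by rewrite negb_and; case: eqP => [->|_]; rewrite ?jJ ?orbT.
exists (fun J' => if J' == J then p@_mu *: 'X_[mu - e] else 0); split.
  by move=> J' KJ'; case: eqP => // e'; rewrite e' in KJ'.
rewrite (bigD1 J) //= eqxx [X in _ + X]big1 => [|J' /negPf ->]; last by rewrite mul0r.
have -> : \prod_(j in J) 'X_j = 'X_[e] :> A.
  by rewrite (big_morph _ (@mpolyXD m k) (mpolyX0 m k)).
by rewrite addr0 -scalerAl -mpolyXD submK.
Qed.

Variable X : graded_free_resolution I.
Notation rk := (res_rank X).
Notation dif := (res_diff X).
Notation wt p := (@res_deg _ _ _ X p).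
Notation aug := (res_aug X).
Notation bihom := (has_bidegree true).
Notation kosT r := {ffun {set 'I_m} -> 'rV[A]_r}.
Variable deg : nat.

Lemma res_diff_diff p : dif p.+1 *m dif p = 0.
Proof.
apply/row_matrixP => i; rewrite row_mul row0; apply/res_exact.
by exists (delta_mx 0 i); rewrite -rowE.
Qed.

Lemma rmul_diff_diff p (x : kosT (rk p.+2)) : rmul (rmul x (dif p.+1)) (dif p) = 0.
Proof. by rewrite rmulA res_diff_diff; apply/ffunP => S; rewrite !ffunE mulmx0. Qed.

Lemma rmul_exact p (x : kosT (rk p.+1)) : rmul x (dif p) = 0 ->
  exists w, x = rmul w (dif p.+1).
Proof.
move=> xd; have /fin_all_exists[w wP] (S : {set 'I_m}) :
    exists w, x S = w *m dif p.+1.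
  apply/res_exact; have := congr1 (fun y : kosT _ => y S) xd.
  by rewrite !ffunE.
by exists [ffun S => w S]; apply/ffunP => S; rewrite !ffunE.
Qed.

Lemma rmul_exact0 (x : kosT (rk 0)) :
  (forall S, I ((x S *m aug) 0 0)) <-> exists w, x = rmul w (dif 0).
Proof.
split=> [xd|[w ->] S]; last by rewrite ffunE; apply/res_exact0; exists (w S).
have /fin_all_exists[w wP] (S : {set 'I_m}) : exists w, x S = w *m dif 0.
  exact/res_exact0.
by exists [ffun S => w S]; apply/ffunP => S; rewrite !ffunE.
Qed.

Definition zact (r : nat) (a : k) (x : kosT r) : kosT r := a%:MP *: x.

(** In the double complex with entries X_p (x) /\^q, the sum of the images of the two incoming
    differentials. *)
Definition zbound p (x : kosT (rk p)) : Prop :=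
  exists u v, x = rmul u (dif p) + kos v.

(** The start of a zig-zag step from (p + 1, q) to (p, q + 1); [zcycle_up] describes the elements at
    the end of such a step. *)
Definition zcycle_down p q (x : kosT (rk p.+1)) : Prop :=
  bihom q deg (wt p.+1) x /\ exists y, rmul x (dif p) = kos y.

Definition zcycle_up p q (y : kosT (rk p)) : Prop :=
  bihom q deg (wt p) y /\ exists x, kos y = rmul x (dif p).

Lemma bihom_diff b p q (x : kosT (rk p.+1)) : has_bidegree b q deg (wt p.+1) x ->
  has_bidegree b q deg (wt p) (rmul x (dif p)).
Proof. apply: has_bidegree_rmul => i j mu; exact: res_diff_homog. Qed.

Lemma bihom_bound p q (x : kosT (rk p)) : bihom q deg (wt p) x -> zbound x ->
  exists u v, [/\ bihom q deg (wt p.+1) u, bihom q.+1 deg (wt p) v &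
                  x = rmul u (dif p) + kos v].
Proof.
move=> hx [u [v xE]]; apply: bihom_lift xE => // i j mu; exact: res_diff_homog.
Qed.

(** Applying the other differential to either equation gives zero, and exactness of the resolution
    or of the Koszul complex yields the other equation. Positive exterior degree excludes the
    constant-term obstruction. *)
Lemma zcycle_down_up p q (x : kosT (rk p.+1)) :
  zcycle_down q.+1 x <-> zcycle_up q.+1 x.
Proof.
split=> -[hx [y xy]]; split=> //.
  by apply: rmul_exact; rewrite -kos_rmul xy kos_kos.
apply: kos_exact => [|c]; last exact: bihom_set0 (bihom_diff hx).
by rewrite kos_rmul xy rmul_diff_diff.
Qed.

(** Elements x and y are related when the resolution differential of x equals [kos y]. If x = d u +
    [kos] v, then y - d v is a Koszul cycle, hence a Koszul boundary; if y = d u + [kos] v, then x -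
    [kos] u is killed by d, hence in its image. *)
Lemma zrank_step p q r :
  act_has_rank (@zact _) (@zcycle_up p q.+1) (@zbound p) r ->
  act_has_rank (@zact _) (@zcycle_down p q) (@zbound p.+1) r.
Proof.
apply: (@act_has_rank_transfer k _ _ _ _ _ _ _ _ (fun x y =>
  [/\ bihom q deg (wt p.+1) x, bihom q.+1 deg (wt p) y &
      rmul x (dif p) = kos y])).
- split; try exact: has_bidegree0.
  by apply/ffunP => S; rewrite !ffunE mul0mx big1 // => j; rewrite ffunE scaler0.
- move=> x y x' y' [hx hy xy] [hx' hy' xy']; split; try exact: has_bidegreeD.
  by rewrite rmulD kosD xy xy'.
- move=> a x y [hx hy xy]; split; try exact: has_bidegreeZ.
  by rewrite rmulZ kosZ xy.
- move=> x [hx [y xy]]; have [y' hy' xy'] := bihom_lift_kos (bihom_diff hx) xy.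
  by exists y'; split=> //; split=> //; exists x.
- move=> y [hy [x xy]].
  have [x' hx' xy'] : exists2 x', bihom q deg (wt p.+1) x' & kos y = rmul x' (dif p).
    by apply: bihom_lift_rmul (has_bidegree_kos hy) xy => i j mu; exact: res_diff_homog.
  by exists x'; split=> //; split=> //; exists y.
- move=> x y [hx hy xy]; split.
    move=> /(bihom_bound hx)[u [v [hu hv xE]]].
    have [||w yE] := @kos_exact k m _ (y - rmul v (dif p)).
    + by rewrite kosB -xy xE kos_rmul rmulD rmul_diff_diff add0r subrr.
    + move=> c; apply: (@bihom_set0 _ _ q deg _ (wt p)).
      by apply: has_bidegreeB => //; exact: bihom_diff.
    by exists v, w; rewrite -yE addrC subrK.
  move=> [u [v yE]].
  have [|w xE] := @rmul_exact _ (x - kos u).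
    by rewrite rmulB xy yE kosD kos_kos addr0 kos_rmul subrr.
  by exists w, u; rewrite -xE subrK.
Qed.

(** Each step trades one unit of resolution degree for one of exterior degree, until resolution
    degree 0 is reached. *)
Lemma zrank_chain p q r :
  act_has_rank (@zact _) (@zcycle_up 0 (p + q.+1)) (@zbound 0) r ->
  act_has_rank (@zact _) (@zcycle_down p q) (@zbound p.+1) r.
Proof.
elim: p q => [|p IH] q h; first exact: zrank_step.
apply: zrank_step; rewrite addSnnS in h; have [[z [Zz fz]] mz] := IH _ h.
split; first by exists z; split=> // l; exact/zcycle_down_up.
by move=> z' Zz'; apply: mz => l; exact/zcycle_down_up.
Qed.

(** In exterior degree 0 the image of [kos] consists of the chains without constant term, so taking
    constant coefficients identifies the end of the zig-zag with the complex that computes Tor. *)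
Lemma tor_rank i r :
  act_has_rank (@zact _) (@zcycle_down i 0) (@zbound i.+1) r ->
  bigraded_betti X i.+1 deg r.
Proof.
pose emb p (v : 'rV[k]_(rk p)) : kosT (rk p) :=
  [ffun S => if S == set0 then map_mx (@mpolyC m k) v else 0].
have emb_hom p v : in_degree deg v -> bihom 0 deg (wt p) (emb p v).
  move=> hv S c mu; rewrite ffunE.
  case: eqP => [->|_]; last by rewrite mxE mcoeff_msupp mcoeff0 eqxx.
  rewrite mxE msuppC; case: eqP => // /eqP v0; rewrite inE => /eqP ->.
  by rewrite cards0 mdeg0 double0 addn0 (hv _ v0) !eqxx.
(* A chain in exterior degree 0 is a Koszul cycle, so [kos_exact] leaves only its constant term as
   obstruction. *)
have const_kos p (x : kosT (rk p)) : bihom 0 deg (wt p) x ->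
    (exists y, x = kos y) <-> map_mx (mcoeff 0%MM) (x set0) = 0.
  move=> hx; split=> [[y ->]|x0].
    apply/rowP => c; rewrite !mxE mcoeff_kos big1 // => j.
    by rewrite mnm0E eqxx andbF.
  apply: kos_exact; last first.
    by move=> c; have /rowP/(_ c) := x0; rewrite !mxE.
  apply/ffunP => S; rewrite !ffunE big1 // => j _.
  suff -> : x (j |: S) = 0 by rewrite scaler0.
  apply/rowP => c.
  rewrite mxE; apply/mpolyP => mu; rewrite mcoeff0; apply/eqP.
  rewrite mcoeff_eq0; apply/negP => /hx /andP[/eqP].
  by move/eqP; rewrite cards_eq0 => /eqP/setP/(_ j); rewrite !inE eqxx.
have const_dif p (x : kosT (rk p.+1)) :
    map_mx (mcoeff 0%MM) (rmul x (dif p) set0) =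
    map_mx (mcoeff 0%MM) (x set0) *m tor_diff X p.
  by rewrite ffunE map_mxM.
have embK p v : map_mx (mcoeff 0%MM) (emb p v set0) = v.
  by apply/rowP => c; rewrite ffunE eqxx !mxE mcoeffC eqxx mulr1.
have hom_in p x : bihom 0 deg (wt p) x ->
    in_degree deg (map_mx (mcoeff 0%MM) (x set0)).
  move=> hx c; rewrite mxE -mcoeff_msupp => /hx /andP[_ /eqP <-].
  by rewrite mdeg0 cards0 double0 addn0.
apply: (@act_has_rank_transfer k _ _ _ _ _ _ _ _ (fun z x =>
  bihom 0 deg (wt i.+1) x /\ z = map_mx (mcoeff 0%MM) (x set0))).
- split; first exact: has_bidegree0.
  by apply/rowP => c; rewrite ffunE !mxE mcoeff0.
- move=> z x z' x' [hx ->] [hx' ->]; split; first exact: has_bidegreeD.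
  by apply/rowP => c; rewrite ffunE !mxE mcoeffD.
- move=> a z x [hx ->]; split; first exact: has_bidegreeZ.
  by apply/rowP => c; rewrite ffunE !mxE mcoeffCM.
- move=> z [dz zt]; exists (emb _ z); split; last first.
    by rewrite embK; split=> //; exact: emb_hom.
  split; first exact: emb_hom.
  by apply/const_kos; [exact/bihom_diff/emb_hom|rewrite const_dif embK].
- move=> x [hx ex]; exists (map_mx (mcoeff 0%MM) (x set0)); split=> //.
  split; first exact: hom_in.
  by rewrite -const_dif; apply/const_kos => //; exact: bihom_diff.
- move=> z x [hx ->]; split=> [[y [dy zE]]|].
    have [v xE] : exists v, x - rmul (emb _ y) (dif i.+1) = kos v.
      apply/const_kos.
        by apply: has_bidegreeB => //; exact/bihom_diff/emb_hom.
      have -> : map_mx (mcoeff 0%MM) ((x - rmul (emb _ y) (dif i.+1)) set0) =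
         map_mx (mcoeff 0%MM) (x set0) -
         map_mx (mcoeff 0%MM) (rmul (emb _ y) (dif i.+1) set0).
        by apply/rowP => c; rewrite !ffunE !mxE mcoeffB.
      by rewrite const_dif embK -zE subrr.
    by exists (emb _ y), v; rewrite -xE addrC subrK.
  move=> /(bihom_bound hx)[u [v [hu hv xE]]].
  exists (map_mx (mcoeff 0%MM) (u set0)); split; first exact: hom_in.
  rewrite -const_dif xE; apply/rowP => c; rewrite !mxE ffunE mxE mcoeffD.
  by rewrite mcoeff_kos [X in _ + X]big1 ?addr0 // => j; rewrite mnm0E eqxx andbF.
Qed.

End StanleyReisner.

(** * The linear strand *)

Section LinearStrand.
Local Open Scope ring_scope.
Variables (k : idomainType) (m : nat) (K : {set 'I_m} -> Prop) (cp : rel 'I_m).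
Notation A := {mpoly k[m]}.
Notation I := (@SR_ideal k m K).
Notation bihom := (has_bidegree true).
Notation kosT r := {ffun {set 'I_m} -> 'rV[A]_r}.

Hypothesis K_sub : forall J J' : {set 'I_m}, J' \subset J -> K J -> K J'.
Hypothesis K_one : forall j, K [set j].
Hypothesis K_edge : forall i j, i != j -> K [set i; j] <-> cp i j.

Lemma SR_mcoeff (p : A) (J : {set 'I_m}) (mu : 'X_{1..m}) : I p -> K J ->
  (forall j, mu j != 0%N -> j \in J) -> p@_mu = 0.
Proof.
move=> Ip KJ muJ; apply/eqP; rewrite mcoeff_eq0; apply/negP => /(SR_msupp Ip).
move=> [J' [nKJ' J'mu]]; apply: nKJ'; apply: K_sub KJ.
by apply/subsetP => j /J'mu /muJ.
Qed.

Lemma SR_mcoeff1 (p : A) j : I p -> p@_U_(j) = 0.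
Proof.
move=> Ip; apply: SR_mcoeff Ip (K_one j) _ => l.
by rewrite mnm1E inE [l == j]eq_sym; case: (j == l).
Qed.

Lemma SR_mcoeff_square (p : A) j : I p -> p@_(U_(j) + U_(j)) = 0.
Proof.
move=> Ip; apply: SR_mcoeff Ip (K_one j) _ => l.
by rewrite mnmDE mnm1E inE [l == j]eq_sym; case: (j == l).
Qed.

Lemma SR_mcoeff_edge (p : A) i j : I p -> i != j -> cp i j ->
  p@_(U_(i) + U_(j)) = 0.
Proof.
move=> Ip ij /(K_edge ij) Kij; apply: SR_mcoeff Ip Kij _ => l.
by rewrite mnmDE !mnm1E !inE ![l == _]eq_sym; case: (i == l); case: (j == l).
Qed.

Variable X : graded_free_resolution I.
Notation rk := (res_rank X).
Notation dif := (res_diff X).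
Notation wt p := (@res_deg _ _ _ X p).
Notation aug := (res_aug X).
Variable i : nat.
Notation deg := (i.+1).*2.
Notation zc := (zcycle_up (X := X) (p := 0) deg i).
Notation wt0 := (fun _ : 'I_1 => 0%N).

Lemma bihom_aug b q d (x : kosT (rk 0)) : has_bidegree b q d (wt 0) x ->
  has_bidegree b q d wt0 (rmul x aug).
Proof.
apply: has_bidegree_rmul => r c mu; rewrite ord1 add0n; exact: res_aug_homog.
Qed.

Lemma entryB r (x y : kosT r) S c : (x - y) S 0 c = x S 0 c - y S 0 c.
Proof. by rewrite !ffunE !mxE. Qed.

(** Internal degree 2(i + 1) and exterior degree i leave polynomial degree 1. *)
Lemma strand_support (f : kosT 1) (S : {set 'I_m}) mu : bihom i deg wt0 f ->
  mu \in msupp (f S 0 0) -> #|S| = i /\ exists j, mu = U_(j)%MM.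
Proof.
move=> hf /hf /andP[/eqP -> ]; rewrite add0n => /eqP e; split=> //.
have /mdeg1P[j /eqP ->] : mdeg mu == 1%N by move: e; rewrite -!muln2; lia.
by exists j.
Qed.

Lemma strand_eq0 (f : kosT 1) (S : {set 'I_m}) : bihom i deg wt0 f ->
  (#|S| = i -> forall j, (f S 0 0)@_U_(j) = 0) -> f S 0 0 = 0.
Proof.
move=> hf f0; apply/mpolyP => mu; rewrite mcoeff0; apply/eqP.
rewrite mcoeff_eq0; apply/negP => h.
have [Si [j e]] := strand_support hf h.
by move: h; rewrite mcoeff_msupp e f0 ?eqxx.
Qed.

Lemma aug_kos_mem (x : kosT (rk 0)) : (exists w, kos x = rmul w (dif 0)) <->
  forall S, I (kos (rmul x aug) S 0 0).
Proof.
split=> [/rmul_exact0 h S|h].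
  by have := h S; rewrite kos_rmul [in X in _ -> X]ffunE.
by apply/rmul_exact0 => S; have := h S; rewrite kos_rmul [in X in X -> _]ffunE.
Qed.

(* The sign makes the boundary of e_J have all its coefficients equal to 1. *)
Definition strand_coef (f : kosT 1) (J : {set 'I_m}) (j : 'I_m) : k :=
  kos_sign k j (J :\ j) * (f (J :\ j) 0 0)@_U_(j).

Lemma strand_coefK (f : kosT 1) (S : {set 'I_m}) j : j \notin S ->
  (f S 0 0)@_U_(j) = kos_sign k j S * strand_coef f (j |: S) j.
Proof.
by move=> jS; rewrite /strand_coef setU1K // mulrA kos_sign_sq mul1r.
Qed.

(** The coefficient of v_j^2 in [kos f] at S - j comes from this term alone, and it vanishes because
    {j} is a simplex. *)
Lemma strand_diag (f : kosT 1) (S : {set 'I_m}) j : (forall T, I (kos f T 0 0)) ->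
  j \in S -> (f S 0 0)@_U_(j) = 0.
Proof.
move=> hf jS; have := SR_mcoeff_square j (hf (S :\ j)).
rewrite mcoeff_kos (bigD1 j) /=; last by rewrite !inE eqxx mnmDE mnm1E eqxx.
rewrite big1 ?addr0 => [|l /andP[/andP[_ ml] lj]].
  rewrite setD1K // addmK => /(congr1 (fun a => kos_sign k j (S :\ j) * a)).
  by rewrite mulrA kos_sign_sq mul1r mulr0.
by move: ml; rewrite mnmDE mnm1E [j == l]eq_sym (negPf lj).
Qed.

(** In [kos f] at J - j - l, the coefficient of v_j v_l is, up to sign, the difference of the two
    values. It vanishes since {j, l} is a simplex. *)
Lemma strand_compat (f : kosT 1) (J : {set 'I_m}) j l : (forall T, I (kos f T 0 0)) ->
  j \in J -> l \in J -> cp j l -> strand_coef f J j = strand_coef f J l.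
Proof.
move=> hf jJ lJ cjl; have [->//|jl] := eqVneq j l.
pose S := J :\ j :\ l.
have jS : j \notin S by rewrite !inE eqxx andbF.
have lS : l \notin S by rewrite !inE eqxx.
have lJj : l |: S = J :\ j by rewrite setD1K // !inE eq_sym jl.
have jJl : j |: S = J :\ l.
  by apply/setP => t; rewrite !inE; have [->|//] := eqVneq t j; rewrite jl jJ.
have := SR_mcoeff_edge (hf S) jl cjl.
rewrite mcoeff_kos (bigD1 j) /=; last by rewrite jS mnmDE mnm1E eqxx.
rewrite (bigD1 l) /=; last by rewrite lS mnmDE !mnm1E eqxx addn1 [l == j]eq_sym jl.
rewrite big1 ?addr0 => [|t /andP[/andP[/andP[_ mt] tj] tl]]; last first.
  by move: mt; rewrite mnmDE !mnm1E ![_ == t]eq_sym (negPf tl) (negPf tj).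
rewrite addmK addmC addmK jJl lJj !strand_coefK ?inE ?eqxx //.
rewrite !setD1K // -jJl -lJj.
move: (strand_coef f J l) (strand_coef f J j) => u v.
rewrite !mulrA kos_sign_swap // mulNr addrC => /eqP; rewrite subr_eq0 => /eqP e.
apply: (can_inj (g := fun a => kos_sign k l S * kos_sign k j (l |: S) * a) _ e).
by move=> a; rewrite mulrA mulrACA !kos_sign_sq !mul1r.
Qed.

Notation phiT := {ffun {set 'I_m} * 'I_m -> k}.
Definition phi_act (a : k) (f : phiT) : phiT := [ffun p => a * f p].
(* The values f (J, j) with j \notin J or #|J| <> i.+1 are irrelevant: they are
   unconstrained in cycles and in boundaries. *)
Definition phi_cycle (f : phiT) : Prop := forall (J : {set 'I_m}) j l,
  #|J| = i.+1 -> j \in J -> l \in J -> cp j l -> f (J, j) = f (J, l).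
Definition phi_bound (f : phiT) : Prop := forall (J : {set 'I_m}) j l,
  #|J| = i.+1 -> j \in J -> l \in J -> f (J, j) = f (J, l).

(** A preimage modulo I is cut down to the right bidegree. The discarded part shares no monomial
    with the remaining difference, and I is a monomial ideal, so membership persists. *)
Lemma aug_surj (f : kosT 1) q : bihom q deg wt0 f ->
  exists2 x : kosT (rk 0), bihom q deg (wt 0) x &
    forall S, I (f S 0 0 - rmul x aug S 0 0).
Proof.
move=> hf; have /fin_all_exists[v vP] (S : {set 'I_m}) :=
  @res_aug_surj _ _ _ X (f S 0 0).
pose x0 : kosT (rk 0) := [ffun S => v S].
have [x [y [xE hx hy]]] := bihom_split q deg (wt 0) x0.
exists x => // S.
have h1 := bihom_aug hx; have h2 := bihom_aug hy.
have {vP} := vP S.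
have -> : v S *m aug = rmul x aug S + rmul y aug S.
rewrite !ffunE -mulmxDl; congr (_ *m _).
  by have := congr1 (fun z : kosT (rk 0) => z S) xE; rewrite !ffunE.
rewrite mxE opprD addrA => Iall.
have hfx : bihom q deg wt0 (f - rmul x aug) by exact: has_bidegreeB.
apply: SR_mem => mu mu1; apply: (SR_msupp Iall).
have mu2 : mu \in msupp ((f - rmul x aug) S 0 0).
  by move: mu1; rewrite !ffunE !mxE.
rewrite mcoeff_msupp mcoeffB.
suff -> : (rmul y aug S 0 0)@_mu = 0 by rewrite subr0 -mcoeff_msupp.
by apply/eqP; rewrite mcoeff_eq0; apply/negP => /h2; rewrite (hfx _ _ _ mu2).
Qed.

Lemma kos_mem (f : kosT 1) S : (forall T, I (f T 0 0)) -> I (kos f S 0 0).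
Proof.
move=> hf; rewrite ffunE summxE; apply: SR_sum => j _; rewrite mxE; exact: SRM.
Qed.

Lemma aug_bound_mem (u : kosT (rk 1)) S : I (rmul (rmul u (dif 0)) aug S 0 0).
Proof. by rewrite ffunE; move: S; apply/rmul_exact0; exists u. Qed.

Lemma strand_coef_mem (f f' : kosT 1) J j : (forall T, I (f T 0 0 - f' T 0 0)) ->
  strand_coef f J j = strand_coef f' J j.
Proof.
move=> ff'; congr (_ * _); apply/eqP; rewrite -subr_eq0 -mcoeffB.
by rewrite SR_mcoeff1.
Qed.

Lemma strand_coef_kos (f : kosT 1) (J : {set 'I_m}) j : j \in J ->
  strand_coef (kos f) J j = (f J 0 0)@_0.
Proof.
move=> jJ; rewrite /strand_coef mcoeff_kos (bigD1 j) /=; last first.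
  by rewrite !inE eqxx mnm1E eqxx.
rewrite big1 ?addr0 => [|l /andP[/andP[_ ml] lj]]; last first.
  by move: ml; rewrite mnm1E [j == l]eq_sym (negPf lj).
rewrite mulrA kos_sign_sq mul1r setD1K //; congr (_@__).
by apply/mnmP => l; rewrite mnmBE mnm0E subnn.
Qed.

(** A section of [strand_coef]: it has the prescribed values on (i+1)-sets and no term v_j e_S with
    j in S. *)
Definition strand_of (f : phiT) : kosT 1 := [ffun S : {set 'I_m} => \row__
  if #|S| == i then
    \sum_(j | j \notin S) (kos_sign k j S * f (j |: S, j)) *: 'X_j else 0].

Lemma strand_of_bihom f : bihom i deg wt0 (strand_of f).
Proof.
move=> S c mu; rewrite ffunE mxE.
case: eqP => Si; last by rewrite mcoeff_msupp mcoeff0 eqxx.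
move=> /msupp_sumP[j _ /msuppZ_le]; rewrite msuppX inE => /eqP ->.
by rewrite mdeg1 Si eqxx.
Qed.

Lemma strand_coef_of f (J : {set 'I_m}) j : #|J| = i.+1 -> j \in J ->
  strand_coef (strand_of f) J j = f (J, j).
Proof.
move=> Ji jJ; rewrite /strand_coef ffunE mxE.
have -> : #|J :\ j| = i by apply/eqP; rewrite -eqSS -Ji (cardsD1 j J) jJ add1n.
rewrite eqxx raddf_sum (bigD1 j) /=; last by rewrite !inE eqxx.
rewrite big1 ?addr0 => [|l /andP[_ lj]]; last first.
  by rewrite mcoeffZ mcoeffXU (negPf lj) mulr0.
by rewrite mcoeffZ mcoeffXU eqxx mulr1 mulrA kos_sign_sq mul1r setD1K.
Qed.

(** The two contributions to v_j v_l cancel by the cycle condition when j and l are compatible;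
    otherwise v_j v_l itself lies in I. *)
Lemma strand_of_cycle f S : phi_cycle f -> I (kos (strand_of f) S 0 0).
Proof.
move=> hf; rewrite ffunE summxE; have [Si|Si] := eqVneq #|S|.+1 i; last first.
  rewrite big1 => [|j jS]; first exact: SR0.
  rewrite mxE ffunE mxE cardsU1 jS add1n.
  by rewrite (negPf Si) mulr0.
pose a j l : A :=
  (kos_sign k j S * kos_sign k l (j |: S) * f (l |: (j |: S), l)) *: ('X_j * 'X_l).
have -> : \sum_(j | j \notin S) ((kos_sign A j S * 'X_j) *: strand_of f (j |: S)) 0 0
   = \sum_(j | j \notin S) \sum_(l | (l \notin S) && (l != j)) a j l.
  apply: eq_bigr => j jS; rewrite mxE ffunE mxE cardsU1 jS add1n Si eqxx mulr_sumr.
  apply: eq_big => [l|l _]; first by rewrite !inE negb_or andbC.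
  by rewrite /a kos_signC mul_mpolyC -scalerAl -scalerAr scalerA mulrA.
apply: antisymmetric_sum; [exact: SR0 | exact: SRD |] => j l jl jS lS.
have jnl : j != l by rewrite neq_ltn jl.
rewrite /a ['X_l * _]mulrC setUCA -scalerDl.
have [cjl|cjl] := boolP (cp j l).
  rewrite (hf (j |: (l |: S)) j l) ?inE ?eqxx ?orbT //.
    by rewrite -mulrDl kos_sign_swap // addNr mul0r scale0r; exact: SR0.
  by rewrite !cardsU1 !inE negb_or jnl lS jS !add1n Si.
rewrite -mul_mpolyC; apply/SRM/SR_X => //; by move/K_edge => /(_ jnl); apply/negP.
Qed.

(** Through the augmentation, a chain over the 0-th module of the resolution becomes a linear chain
    over A/I, recorded by its strand coefficients. *)
Lemma strand_rank r :
  act_has_rank phi_act phi_cycle phi_bound r ->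
  act_has_rank (@zact _ _ _) zc (zbound (X := X) (p := 0)) r.
Proof.
pose rho (x : kosT (rk 0)) (f : phiT) :=
  [/\ bihom i deg (wt 0) x, forall S, I (kos (rmul x aug) S 0 0) &
    forall (J : {set 'I_m}) j, #|J| = i.+1 -> j \in J ->
      f (J, j) = strand_coef (rmul x aug) J j].
apply: (@act_has_rank_transfer k _ _ (@zact _ _ _) phi_act _ _ phi_cycle phi_bound rho).
- split; first exact: has_bidegree0.
    move=> S; apply: kos_mem => T; rewrite ffunE ffunE mul0mx mxE; exact: SR0.
  by move=> J j _ _; rewrite /strand_coef !ffunE mul0mx mxE mcoeff0 mulr0.
- move=> x f x' f' [hx kx fx] [hx' kx' fx']; split.
  + exact: has_bidegreeD.
  + by move=> S; rewrite rmulD kosD ffunE mxE; apply: SRD.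
  + move=> J j Ji jJ; rewrite ffunE fx // fx' // /strand_coef -mulrDr -mcoeffD.
    by rewrite rmulD [in RHS]ffunE mxE.
- move=> a x f [hx kx fx]; split.
  + exact: has_bidegreeZ.
  + by move=> S; rewrite rmulZ kosZ ffunE mxE; apply: SRM.
  + move=> J j Ji jJ; rewrite ffunE fx // /strand_coef.
    by rewrite rmulZ [in RHS]ffunE mxE mcoeffCM mulrCA.
- move=> x [hx /aug_kos_mem kx].
  exists [ffun p => strand_coef (rmul x aug) p.1 p.2]; split.
    by move=> J j l Ji jJ lJ cjl; rewrite !ffunE /= (strand_compat kx jJ lJ cjl).
  by split=> // J j _ _; rewrite ffunE.
- move=> f hf; have [x hx fx] := aug_surj (@strand_of_bihom f).
  have kx S : I (kos (rmul x aug) S 0 0).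
    have -> : kos (rmul x aug) S 0 0 = kos (strand_of f) S 0 0 -
        kos (strand_of f - rmul x aug) S 0 0.
      by rewrite kosB entryB opprB addrC subrK.
    apply: SRB; first exact: strand_of_cycle.
    by apply: kos_mem => T; rewrite entryB.
  exists x; split; first by split=> //; apply/aug_kos_mem.
  split=> // J j Ji jJ; rewrite -(@strand_coef_mem (strand_of f)) //.
  by rewrite strand_coef_of.
- move=> x f [hx kx fx]; split=> [xb|fb].
    have [u [v [_ hv xE]]] := bihom_bound hx xb.
    have E (J : {set 'I_m}) j : #|J| = i.+1 -> j \in J ->
        f (J, j) = (rmul v aug J 0 0)@_0.
      move=> Ji jJ; rewrite fx // -(strand_coef_kos _ jJ); apply: strand_coef_mem => T.
      rewrite -entryB xE rmulD kos_rmul addrK.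
      exact: aug_bound_mem.
    by move=> J j l Ji jJ lJ; rewrite !E.
  (* When f is constant on each J, the constants c_J give the chain sum of c_J e_J, whose Koszul
     boundary has strand coefficients f. *)
  pose fv : kosT 1 := [ffun J : {set 'I_m} => \row__ if #|J| == i.+1 then
     (if [pick j in J] is Some j then f (J, j) else 0)%:MP else 0].
  have hfv : bihom i.+1 deg wt0 fv.
    move=> S c mu; rewrite ffunE mxE.
    case: eqP => Si; last by rewrite mcoeff_msupp mcoeff0 eqxx.
    by rewrite msuppC; case: eqP => // _; rewrite inE => /eqP ->; rewrite mdeg0 Si eqxx.
  have [v hv fvv] := aug_surj hfv.
  have vE (J : {set 'I_m}) j : #|J| = i.+1 -> j \in J -> (rmul v aug J 0 0)@_0 = f (J, j).
    move=> Ji jJ; have <- : (fv J 0 0)@_0 = f (J, j).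
      rewrite ffunE mxE Ji eqxx mcoeffC eqxx mulr1.
      by case: pickP => [l lJ|/(_ j)]; [exact: fb|rewrite jJ].
    apply/eqP; rewrite eq_sym -subr_eq0 -mcoeffB.
    rewrite (SR_mcoeff (J := set0) (fvv J)) // => [|l]; last by rewrite mnm0E.
    by apply: K_sub (K_one j); rewrite sub0set.
  (* After augmentation x and [kos v] have the same linear coefficients, those with j in S being
     zero on both sides; so their difference comes from the next module of the resolution. *)
  have [w xE] : exists w, x - kos v = rmul w (dif 0).
    apply/rmul_exact0 => S.
    suff: rmul (x - kos v) aug S 0 0 = 0 by rewrite ffunE => ->; exact: SR0.
    apply: strand_eq0 => [|Si j].
      by apply: bihom_aug; apply: has_bidegreeB => //; exact: has_bidegree_kos.
    rewrite rmulB -kos_rmul entryB.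
    rewrite mcoeffB; apply/eqP; rewrite subr_eq0; apply/eqP.
    have [jS|jS] := boolP (j \in S).
      rewrite strand_diag // mcoeff_kos big1 // => l /andP[lS].
      by rewrite mnm1E; case: (eqVneq j l) lS => // <-; rewrite jS.
    have Ji : #|j |: S| = i.+1 by rewrite cardsU1 jS Si.
    rewrite !strand_coefK // -fx ?setU11 // strand_coef_kos ?setU11 //.
    by rewrite (vE _ j) ?setU11.
  by exists w, v; rewrite -xE subrK.
Qed.

End LinearStrand.

(** * Rank of the strand from a bound on mutually incompatible families *)

Section StrandRank.
Local Open Scope ring_scope.
Variables (k : idomainType) (m : nat) (inc : rel 'I_m) (imax : nat).
Notation phiT := {ffun {set 'I_m} * 'I_m -> k}.
Notation compat := (fun j l => ~~ inc j l).

Hypothesis inc_irr : irreflexive inc.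
Hypothesis inc_sym : ssrbool.symmetric inc.
Hypothesis imax_gt2 : (2 < imax)%N.
Hypothesis inc_bound : forall J1 J2 : {set 'I_m}, J1 != set0 -> J2 != set0 ->
  (forall j l, j \in J1 -> l \in J2 -> inc j l) ->
  (#|J1| + #|J2| <= imax.+1)%N /\
  ((#|J1| + #|J2|)%N = imax.+1 -> (#|J1| == 1%N) || (#|J2| == 1%N)).

(** For special g these are the sets of size [imax.+1] on which a cycle can be nonconstant. *)
Definition inc_star (g : 'I_m) : {set 'I_m} := g |: [set j | inc g j].
Definition inc_special : {set 'I_m} := [set g | #|[set j | inc g j]| == imax].

Lemma card_inc g : (#|[set j | inc g j]| <= imax)%N.
Proof.
have [->|n0] := eqVneq [set j | inc g j] set0; first by rewrite cards0.
have g0 : [set g] != set0 by apply/set0Pn; exists g; rewrite inE.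
have [|+ _] := inc_bound g0 n0; last by rewrite cards1 add1n.
by move=> j l; rewrite !inE => /eqP ->.
Qed.

Lemma inc_star_card g : g \in inc_special -> #|inc_star g| = imax.+1.
Proof. by rewrite inE cardsU1 inE inc_irr => /eqP ->. Qed.

Lemma single_special (J1 J2 : {set 'I_m}) :
  (forall j l, j \in J1 -> l \in J2 -> inc j l) -> #|J1| = 1%N ->
  (#|J1| + #|J2|)%N = imax.+1 ->
  exists2 g, g \in inc_special & J1 = [set g] /\ J1 :|: J2 = inc_star g.
Proof.
move=> h /eqP/cards1P[g J1E]; rewrite J1E cards1 add1n => -[J2c].
have sub : J2 \subset [set j | inc g j].
  by apply/subsetP => j jJ2; rewrite inE; apply: h => //; rewrite J1E inE.
have J2E : J2 = [set j | inc g j].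
  by apply/eqP; rewrite eqEcard sub J2c card_inc.
exists g; first by rewrite inE -J2E J2c.
by split=> //; rewrite J2E.
Qed.

Lemma card_set_ne0 (J : {set 'I_m}) : (0 < #|J|)%N -> J != set0.
Proof. by rewrite card_gt0. Qed.

(** If g and g' had the same star, both would be incompatible with the remaining [imax - 1] members.
    The sizes 2 and [imax - 1] reach the bound, so one of them is 1, contradicting [2 < imax]. *)
Lemma inc_star_inj : {in inc_special &, injective inc_star}.
Proof.
move=> g g' gs gs' e; apply/eqP; apply: contraT => gg'.
have g's : g' \in inc_star g by rewrite e !inE eqxx.
have gs2 : g \in inc_star g by rewrite !inE eqxx.
pose J2 := inc_star g :\ g :\ g'.
have J2c : #|J2|.+2 = imax.+1.
  rewrite -(inc_star_card gs) (cardsD1 g (inc_star g)) gs2.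
  by rewrite (cardsD1 g' (inc_star g :\ g)) in_setD1 eq_sym gg' g's.
have [] := @inc_bound [set g; g'] J2.
- by apply: card_set_ne0; rewrite cards2.
- by apply: card_set_ne0; rewrite -ltnS -ltnS J2c; apply: leq_trans imax_gt2 _.
- move=> j l /set2P[] -> /setD1P[lg'] /setD1P[lg ls].
    by move: ls; rewrite !inE (negPf lg).
  by move: ls; rewrite e !inE (negPf lg').
rewrite cards2 gg' add2n J2c => _ /(_ erefl) /= /eqP J21.
by move: J2c imax_gt2; rewrite J21 => -[<-].
Qed.

(** By the cycle condition every member of the level set of f through j0 is incompatible with every
    member of J outside it, so [inc_bound] applies. The final alternative tells which of the two
    parts is {g}. *)
Lemma phi_level (i : nat) (f : phiT) (J : {set 'I_m}) j0 j1 :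
  (imax <= i)%N -> phi_cycle compat i f -> #|J| = i.+1 ->
  j0 \in J -> j1 \in J -> f (J, j0) <> f (J, j1) ->
  i = imax /\ exists2 g, g \in inc_special & J = inc_star g /\
    ((forall j, j \in J -> f (J, j) = f (J, j0) -> j = g) \/
     (forall j, j \in J -> f (J, j) <> f (J, j0) -> j = g)).
Proof.
move=> imi fc Ji j0J j1J f01.
pose J1 := [set j in J | f (J, j) == f (J, j0)].
pose J2 := [set j in J | f (J, j) != f (J, j0)].
have J12 : J = J1 :|: J2.
  by apply/setP => j; rewrite !inE -andb_orr orbN andbT.
have Jc : (#|J1| + #|J2|)%N = i.+1.
  rewrite -Ji -(cardsID [set j | f (J, j) == f (J, j0)] J).
  by congr (_ + _)%N; apply: eq_card => j; rewrite !inE // andbC.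
have h : forall j l, j \in J1 -> l \in J2 -> inc j l.
  move=> j l; rewrite !inE => /andP[jJ /eqP fj] /andP[lJ fl].
  by apply: contraNT fl => c; rewrite (fc J l j Ji) ?fj // inc_sym.
have [|||le eq1] := @inc_bound J1 J2.
- by apply/set0Pn; exists j0; rewrite inE j0J eqxx.
- by apply/set0Pn; exists j1; rewrite inE j1J; apply/eqP => e; apply: f01.
- exact: h.
have ii : i = imax by apply/eqP; rewrite eqn_leq imi -ltnS -Jc le.
split=> //; rewrite ii in Jc.
case/orP: (eq1 Jc) => /eqP c1.
  have [g gs [J1g Jg]] := single_special h c1 Jc.
  exists g => //; split; first by rewrite {1}J12.
  left=> j jJ /eqP fj; have : j \in J1 by rewrite inE jJ.
  by rewrite J1g inE => /eqP.
rewrite addnC in Jc.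
have h' : forall j l, j \in J2 -> l \in J1 -> inc j l.
  by move=> j l jJ lJ; rewrite inc_sym h.
have [g gs [J2g Jg]] := single_special h' c1 Jc.
exists g => //; split; first by rewrite {1}J12 setUC.
right=> j jJ /eqP fj; have : j \in J2 by rewrite inE jJ.
by rewrite J2g inE => /eqP.
Qed.

Lemma phi_bound0 i : phi_bound i (0 : phiT).
Proof. by move=> J j l _ _ _; rewrite !ffunE. Qed.

Lemma phi_rank_gt i : (imax < i)%N ->
  act_has_rank (@phi_act k m) (phi_cycle compat i) (phi_bound i) 0.
Proof.
move=> im; apply: act_has_rank0; first exact: phi_bound0.
  by move=> a f fb J j l Ji jJ lJ; rewrite !ffunE (fb J j l).
move=> f fc J j l Ji jJ lJ; apply/eqP; apply: contraT => /eqP fjl.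
have [e _] := phi_level (ltnW im) fc Ji jJ lJ fjl.
by rewrite e ltnn in im.
Qed.

(** Each special g gives one coordinate: the value at g minus the value at some d incompatible with
    g, both taken in the star of g. This map is onto, and its kernel on cycles is the boundaries. *)
Lemma phi_rank_eq s : s = #|inc_special| ->
  act_has_rank (@phi_act k m) (phi_cycle compat imax) (phi_bound imax) s.
Proof.
move=> ->; pose ga (l : 'I_#|inc_special|) : 'I_m := enum_val l.
have gaS l : ga l \in inc_special by exact: enum_valP.
have /fin_all_exists[de deP] (l : 'I_#|inc_special|) : exists d, inc (ga l) d.
  have : (0 < #|[set j | inc (ga l) j]|)%N.
    by have := gaS l; rewrite inE => /eqP ->; apply: leq_trans imax_gt2.
  by rewrite card_gt0 => /set0Pn[d]; rewrite inE; exists d.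
pose J l := inc_star (ga l).
have gaJ l : ga l \in J l by rewrite !inE eqxx.
have deJ l : de l \in J l by rewrite !inE deP orbT.
have dega l : de l != ga l by apply: contraTneq (deP l) => ->; rewrite inc_irr.
have Jinj l l' : J l = J l' -> l = l'.
  by move=> e; apply: enum_val_inj; apply: inc_star_inj.
pose pi (f : phiT) : 'rV[k]_#|inc_special| := \row_l (f (J l, ga l) - f (J l, de l)).
pose rho f v := phi_cycle compat imax f /\ v = pi f.
apply: (@act_has_rank_transfer k _ _ (@phi_act k m) *:%R _ _
  (fun=> True) (fun v => v = 0) rho).
- split; first by move=> T j l _ _ _ _; rewrite !ffunE.
  by apply/rowP => l; rewrite !mxE !ffunE subr0.
- move=> f v f' v' [fc ->] [fc' ->]; split.
    by move=> T j l Ti jT lT c; rewrite !ffunE (fc T j l) // (fc' T j l).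
  by apply/rowP => l; rewrite !mxE !ffunE opprD addrACA.
- move=> a f v [fc ->]; split.
    by move=> T j l Ti jT lT c; rewrite !ffunE (fc T j l).
  by apply/rowP => l; rewrite !mxE !ffunE mulrBr.
- by move=> f fc; exists (pi f).
(* The indicator of (star of g, g) is a cycle because g is incompatible with all other members of
   its star. *)
- move=> v _; exists [ffun p => \sum_l v 0 l * (p == (J l, ga l))%:R].
  set f := finfun _.
  have fc : phi_cycle compat imax f.
    move=> T j l Ti jT lT c; rewrite !ffunE; apply: eq_bigr => t _.
    congr (_ * _%:R); rewrite !xpair_eqE; case: eqP => //= TJ.
    move: jT lT c; rewrite TJ !inE.
    have [->|jg] := eqVneq j (ga t); have [->|lg] := eqVneq l (ga t) => //=.
      by move=> _ ->.
    by move=> h _; rewrite inc_sym h.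
  split=> //; split=> //; apply/rowP => l; rewrite mxE !ffunE.
  rewrite (bigD1 l) //= eqxx mulr1 big1 => [|t tl]; last first.
    rewrite xpair_eqE; case: eqP => [/Jinj e|_]; last by rewrite mulr0.
    by rewrite e eqxx in tl.
  rewrite big1 ?subr0 ?addr0 // => t _; rewrite xpair_eqE.
  case: eqP => [/Jinj <-|_]; last by rewrite mulr0.
  by rewrite (negPf (dega l)) mulr0.
- move=> f v [fc ->]; split=> [fb|pif].
    apply/rowP => l; rewrite !mxE (fb (J l) (ga l) (de l)) ?subrr //.
    exact: inc_star_card.
  have pifE l : f (J l, ga l) = f (J l, de l).
    by have /rowP/(_ l) := pif; rewrite !mxE => /eqP; rewrite subr_eq0 => /eqP.
  move=> T j j' Ti jT j'T; apply/eqP; apply: contraT => /eqP fjj'.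
  have [_ [g gs [Tg _]]] := phi_level (leqnn _) fc Ti jT j'T fjj'.
  have [l gl] : exists l, g = ga l.
    by exists (enum_rank_in gs g); rewrite /ga enum_rankK_in.
  have TJ : T = J l by rewrite Tg gl.
  (* [phi_level] is applied again with base point [de l]. Its level set cannot be {ga l}, and its
     complement cannot be either, as f agrees at [de l] and [ga l]. *)
  have [j2 j2T fj2] : exists2 j2, j2 \in T & f (T, de l) <> f (T, j2).
    have [e|/eqP ne] := eqVneq (f (T, de l)) (f (T, j)); last by exists j.
    by exists j' => //; rewrite e.
  have deT : de l \in T by rewrite TJ.
  have [_ [g' gs' [Tg' h]]] := phi_level (leqnn _) fc Ti deT j2T fj2.
  have g'E : g' = ga l by apply: inc_star_inj; rewrite // -Tg' TJ.
  case: h => h.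
    by have := h _ deT erefl; rewrite g'E => e; have := dega l; rewrite e eqxx.
  have := h j2 j2T (fun e => fj2 (esym e)); rewrite g'E => e.
  by case: fj2; rewrite e TJ pifE.
- exact: act_has_rank_rV.
Qed.

End StrandRank.

(** * Crossing diagonals *)

Section Diagonals.
Variable M : nat.
Implicit Types (d e : 'I_M * 'I_M) (J : {set 'I_M * 'I_M}).

Definition cross d e : bool :=
  [&& d.1 < e.1, e.1 < d.2 & d.2 < e.2] || [&& e.1 < d.1, d.1 < e.2 & e.2 < d.2].

Definition ends J : {set 'I_M} :=
  [set v | [exists d in J, (v == d.1) || (v == d.2)]].

Lemma cross_sym d e : cross d e = cross e d.
Proof. by rewrite /cross orbC. Qed.

Lemma ends1 d J : d \in J -> d.1 \in ends J.
Proof. by move=> dJ; rewrite inE; apply/exists_inP; exists d; rewrite ?eqxx. Qed.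

Lemma ends2 d J : d \in J -> d.2 \in ends J.
Proof. by move=> dJ; rewrite inE; apply/exists_inP; exists d; rewrite ?eqxx ?orbT. Qed.

(** Every d in J has one end strictly between the ends of e and the other one not, so J embeds into
    the product of these two sets of endpoints. *)
Lemma cross_rectangle J e : J != set0 -> (forall d, d \in J -> cross d e) ->
  exists u w, [/\ 0 < u, 0 < w, u + w = #|ends J| & #|J| <= u * w].
Proof.
move=> /set0Pn[d0 d0J] h.
pose B := [set v : 'I_M | (e.1 < v) && (v < e.2)].
exists #|ends J :&: B|, #|ends J :\: B|.
pose f d := if d.1 \in B then (d.1, d.2) else (d.2, d.1).
have fP d : d \in J -> (f d).1 \in ends J :&: B /\ (f d).2 \in ends J :\: B.
  move=> dJ; have key : (d.2 \in B) = ~~ (d.1 \in B).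
    by have := h d dJ; rewrite /cross !inE; lia.
  by rewrite /f; case: ifP => c;
    rewrite in_setI in_setD /= key c ends1 // ends2.
split; last 2 first.
- by rewrite cardsID.
- rewrite -cardsX -(card_in_imset (f := f)).
    apply/subset_leq_card/subsetP => _ /imsetP[d dJ ->].
    by rewrite [f d]surjective_pairing; apply/setXP/fP.
  move=> [x y] [x' y'] /h hd /h hd'; rewrite /f.
  move: hd hd'; rewrite /cross /= => hd hd'.
  case: ifP => _; case: ifP => _ // -[] //; first by move=> ? ?; subst; lia.
    by move=> ? ?; subst; lia.
  by move=> -> ->.
- by rewrite card_gt0; apply/set0Pn; exists (f d0).1; have [] := fP _ d0J.
- by rewrite card_gt0; apply/set0Pn; exists (f d0).2; have [] := fP _ d0J.
Qed.

(** Crossing diagonals share no endpoint, so the two endpoint sets are disjoint among the M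
    vertices. *)
Lemma ends_disjoint J1 J2 : (forall d e, d \in J1 -> e \in J2 -> cross d e) ->
  #|ends J1| + #|ends J2| <= M.
Proof.
move=> h; rewrite -cardsUI.
have -> : ends J1 :&: ends J2 = set0.
  apply/setP => v; rewrite !inE; apply/negP => /andP[].
  move=> /exists_inP[d dJ vd] /exists_inP[e eJ ve].
  have := h d e dJ eJ; rewrite /cross.
  by case/orP: vd => /eqP <-; case/orP: ve => /eqP <-; lia.
by rewrite cards0 addn0 -[X in _ <= X]card_ord max_card.
Qed.

End Diagonals.

Lemma mul_le_halves (N x y : nat) : x + y <= N -> x * y <= N./2 * (N - N./2).
Proof.
wlog xy : x y / x <= y => [H|] le.
  by case: (leqP x y) => [/H|/ltnW/H h]; [apply|rewrite mulnC; apply: h; rewrite addnC].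
have NE := odd_double_half N; move: (N./2) (odd N) NE => h b NE.
have -> : N - h = h + b by rewrite -NE -addnn; lia.
have le' : x + y <= h + h + b by rewrite -addnn in NE; lia.
have xh : x <= h by case: b {NE} le' => /=; lia.
(* With h = x + z one has y <= x + 2z + b, and h (h + b) exceeds x (x + 2z + b) by z^2 + z b. *)
have [z hE] : exists z, h = x + z by exists (h - x); rewrite subnKC.
subst h; have : y <= x + z + z + b by lia.
by rewrite -(leq_pmul2l (ltn0Sn x)); nia.
Qed.

Lemma rectangles_bound (N u w s t p q : nat) :
  0 < u -> 0 < w -> 0 < s -> 0 < t -> u + w + (s + t) <= N.+2 ->
  0 < p -> 0 < q -> p <= u * w -> q <= s * t ->
  p + q <= (N./2 * (N - N./2)).+1 /\
  (p + q = (N./2 * (N - N./2)).+1 -> (p == 1) || (q == 1)).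
Proof.
case: u w s t => [|u] [|w] [|s] [|t] // _ _ _ _ le4 p0 q0 pu qs.
(* All four counts are now decreased by 1. The two pairings exceed the sum of the rectangles minus 1
   by u t + s w and by u s + t w. Equality kills all four products: either u = w = 0 and p = 1, or s
   = t = 0 and q = 1. *)
have h1 : (u + s).+1 * (w + t).+1 <= N./2 * (N - N./2).
  by apply: mul_le_halves; lia.
have h2 : (u + t).+1 * (w + s).+1 <= N./2 * (N - N./2).
  by apply: mul_le_halves; lia.
set H := N./2 * (N - N./2) in h1 h2 *.
split; first by nia.
move=> e.
have e1 : u * t = 0 by nia.
have e2 : s * w = 0 by nia.
have e3 : u * s = 0 by nia.
have e4 : t * w = 0 by nia.
have [u0|u0] := posnP u; have [w0|w0] := posnP w; subst;
  try (apply/orP; left; apply/eqP; nia).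
all: apply/orP; right; apply/eqP; nia.
Qed.

Lemma cross_bound (N : nat) (J1 J2 : {set 'I_N.+2 * 'I_N.+2}) :
  J1 != set0 -> J2 != set0 ->
  (forall d e, d \in J1 -> e \in J2 -> cross d e) ->
  #|J1| + #|J2| <= (N./2 * (N - N./2)).+1 /\
  (#|J1| + #|J2| = (N./2 * (N - N./2)).+1 -> (#|J1| == 1) || (#|J2| == 1)).
Proof.
move=> J10 J20 h; have [d0 d0J] := set0Pn _ J10; have [e0 e0J] := set0Pn _ J20.
have [u [w [u0 w0 uw J1c]]] := cross_rectangle J10 (fun d dJ => h d e0 dJ e0J).
have h' e : e \in J2 -> cross e d0 by move=> eJ; rewrite cross_sym h.
have [s [t [s0 t0 st J2c]]] := cross_rectangle J20 h'.
apply: (rectangles_bound u0 w0 s0 t0) => //; rewrite ?card_gt0 // uw st.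
exact: ends_disjoint.
Qed.

(** * Facets of graph-associahedra *)

Section BuildingSet.
Variables (T : finType) (e : rel T).
Implicit Types S U : {set T}.
Notation B := (building_set e).

Lemma building_set1 x : [set x] \in B.
Proof.
rewrite inE /connected_subgraph; apply/andP; split.
  by apply/set0Pn; exists x; rewrite inE.
by apply/forall_inP => y /set1P ->; apply/forall_inP => z /set1P ->; rewrite connect0.
Qed.

Lemma building_setU S U : S \in B -> U \in B -> S :&: U != set0 -> S :|: U \in B.
Proof.
rewrite !inE /connected_subgraph => /andP[S0 cS] /andP[_ cU] /set0Pn[z /setIP[zS zU]].
have cn S' x y : S' \subset S :|: U ->
    [forall x in S', forall y in S',
       connect [rel u v | [&& u \in S', v \in S' & e u v]] x y] ->
    x \in S' -> y \in S' ->
    connect [rel u v | [&& u \in S :|: U, v \in S :|: U & e u v]] x y.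
  move=> /subsetP S'S /forall_inP h xS' yS'.
  have /forall_inP/(_ y yS') := h x xS'; apply: connect_sub => u v /=.
  by move=> /and3P[uS vS uv]; apply: connect1; rewrite /= !S'S.
apply/andP; split.
  by apply/set0Pn; exists z; rewrite inE zS.
have cz x : x \in S :|: U ->
    connect [rel u v | [&& u \in S :|: U, v \in S :|: U & e u v]] x z /\
    connect [rel u v | [&& u \in S :|: U, v \in S :|: U & e u v]] z x.
  by case/setUP => h; split; apply: cn h _ || apply: cn _ h => //;
    rewrite ?subsetUl ?subsetUr.
apply/forall_inP => x /cz[xz _]; apply/forall_inP => y /cz[_].
exact: connect_trans.
Qed.

(** A connected subset of L of maximal cardinality absorbs every connected subset of L that meets
    it. *)
Lemma building_set_component (L : {set T}) x : x \in L -> exists2 S, S \in B &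
  S \subset L /\ forall U, U \in B -> U \subset L -> U :&: S != set0 -> U \subset S.
Proof.
move=> xL; pose Q S := (S \in B) && (S \subset L).
have Qx : Q [set x] by rewrite /Q building_set1 sub1set.
case: (arg_maxnP (fun S => #|S|) Qx) => S /andP[SB SL] maxS.
exists S => //; split=> // U UB UL US.
have := maxS (U :|: S); rewrite /Q building_setU //= subUset UL SL => /(_ isT) h.
have /eqP <- : U :|: S == S by rewrite eq_sym eqEcard subsetUr.
exact: subsetUl.
Qed.

Lemma incompatible_sym S U : incompatible e S U = incompatible e U S.
Proof.
rewrite /incompatible [U :&: S]setIC [U :|: S]setUC.
by case: (S :&: U != U); rewrite ?andbF ?andbT.
Qed.

Lemma incompatible_irr S : S \in B -> incompatible e S S = false.
Proof.
rewrite inE => /andP[S0 _]; rewrite /incompatible setIid eqxx andbF /=.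
by rewrite (negPf S0).
Qed.

Lemma incompatible_union S U : S \in B -> U \in B -> incompatible e S U ->
  [/\ S :|: U \in B, ~~ (S :|: U \subset S) & ~~ (S :|: U \subset U)].
Proof.
move=> SB UB; rewrite !subUset !subxx andbT /=.
have S0 : S != set0 by move: SB; rewrite inE => /andP[].
have U0 : U != set0 by move: UB; rewrite inE => /andP[].
case/orP => [/and3P[SU nS nU]|/andP[/eqP SU c]].
  split; first exact: building_setU.
    by apply: contra nU => /setIidPr ->.
  by apply: contra nS => /setIidPl ->.
split; first by rewrite inE.
  by apply: contra U0 => /setIidPr <-; rewrite SU.
by apply: contra S0 => /setIidPl <-; rewrite SU.
Qed.

(** This selects the vertex of the summand for V when a common point of the faces of S and U is
    built. *)
Lemma compatible_avoid S U V : S \in B -> U \in B -> ~~ incompatible e S U ->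
  V \in B -> exists2 x, x \in V &
    (~~ (V \subset S) -> x \notin S) /\ (~~ (V \subset U) -> x \notin U).
Proof.
move=> SB UB; rewrite /incompatible negb_or => /andP[c1 c2] VB.
have [x0 x0V] : exists x, x \in V by apply/set0Pn; move: VB; rewrite inE => /andP[].
have [VS|VS] := boolP (V \subset S).
  have [VU|/subsetPn[x xV xU]] := boolP (V \subset U); first by exists x0.
  by exists x.
have [VU|VU] := boolP (V \subset U).
  by case/subsetPn: VS => x xV xU; exists x.
have [SU0|SU0] := eqVneq (S :&: U) set0; last first.
  move: c1; rewrite SU0 /= negb_and !negbK => /orP[/eqP/setIidPl SU|/eqP/setIidPr US].
    case/subsetPn: VU => x xV xU; exists x => //; split=> // _.
    by apply: contra xU; apply: (subsetP SU).
  case/subsetPn: VS => x xV xU; exists x => //; split=> // _.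
  by apply: contra xU; apply: (subsetP US).
(* The remaining danger is a V inside the disjoint union of S and U that meets both: it would make
   their union connected. *)
have [VSU|/subsetPn[x xV]] := boolP (V \subset S :|: U); last first.
  by rewrite inE negb_or => /andP[xS xU]; exists x.
case/subsetPn: VS => x xV xS; case/subsetPn: VU => y yV yU.
have yS : y \in S by have := subsetP VSU y yV; rewrite inE (negPf yU) orbF.
have xU : x \in U by have := subsetP VSU x xV; rewrite inE (negPf xS).
have SV : S :|: V \in B.
  by apply: building_setU => //; apply/set0Pn; exists y; rewrite inE yS.
have : (S :|: V) :|: U \in B.
  by apply: building_setU => //; apply/set0Pn; exists x; rewrite !inE xV xU orbT.
rewrite setUAC; have -> : S :|: U :|: V = S :|: U by apply/setUidPl.
by rewrite inE; move: c2; rewrite SU0 eqxx /= => /negPf ->.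
Qed.

End BuildingSet.

(** * Facets of the Minkowski sum *)

Section Facets.
Local Open Scope ring_scope.
Variables (R : realType) (n : nat) (e : rel 'I_n.+1).
Hypothesis conn : connected_subgraph e setT.
Implicit Types (S T : {set 'I_n.+1}) (x y : 'rV[R]_n.+1).
Notation B := (building_set e).
Notation P := (@graph_associahedron R n.+1 e).

Lemma building_setT : setT \in B.
Proof. by rewrite inE. Qed.

Lemma simplex_coord S x : simplex_of S x ->
  [/\ forall j, 0 <= x 0 j, forall j, j \notin S -> x 0 j = 0 & \sum_(j in S) x 0 j = 1].
Proof.
move=> [t [t0 t1 xE]].
have xj j : x 0 j = if j \in S then t j else 0.
  rewrite xE summxE; case: ifP => jS.
    rewrite (bigD1 j) //= big1 ?addr0 ?mxE ?eqxx ?mulr1 // => l /andP[_ lj].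
    by rewrite !mxE eqxx eq_sym (negPf lj) mulr0.
  apply: big1 => l lS; rewrite !mxE eqxx /=.
  case: eqP => [e'|_]; last by rewrite mulr0.
  by rewrite e' lS in jS.
split=> [j|j jS|].
- by rewrite xj; case: ifP.
- by rewrite xj (negPf jS).
by rewrite -t1; apply: eq_bigr => j jS; rewrite xj jS.
Qed.

Lemma simplex_sum S x : simplex_of S x -> \sum_j x 0 j = 1.
Proof.
move=> /simplex_coord[_ x0 <-]; rewrite [RHS]big_mkcond; apply: eq_bigr => j _.
by case: ifPn => // /x0.
Qed.

Lemma simplex_vertex S j : j \in S -> simplex_of S (delta_mx 0 j : 'rV[R]_n.+1).
Proof.
move=> jS; exists (fun l => (l == j)%:R); split.
- by move=> l; rewrite ler0n.
- rewrite (bigD1 j) //= eqxx big1 ?addr0 // => l /andP[_ /negPf ->] //.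
rewrite (bigD1 j) //= eqxx scale1r big1 ?addr0 // => l /andP[_ /negPf ->].
by rewrite scale0r.
Qed.

(** The minimum over P of the sum of the coordinates in S: each summand inside S contributes exactly
    1, and the others can contribute 0. *)
Definition nested_count S : R := #|[set T in B | T \subset S]|%:R.

Definition facet_of S x : Prop := P x /\ \sum_(j in S) x 0 j <= nested_count S.

Lemma sum_decomp (p : {set 'I_n.+1} -> 'rV[R]_n.+1) S :
  (forall T, T \in B -> simplex_of T (p T)) ->
  \sum_(j in S) (\sum_(T in B) p T) 0 j =
  nested_count S + \sum_(T in B | ~~ (T \subset S)) \sum_(j in S) p T 0 j.
Proof.
move=> hp; under eq_bigr => j _ do rewrite summxE.
rewrite exchange_big /= (bigID (fun T => T \subset S)) /=; congr (_ + _).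
rewrite (eq_bigr (fun=> 1)) => [|T /andP[TB TS]].
  by rewrite /nested_count -sum1_card natr_sum; apply: eq_bigl => T; rewrite !inE.
have [_ p0 <-] := simplex_coord (hp T TB).
rewrite [RHS]big_mkcond [LHS]big_mkcond; apply: eq_bigr => j _.
case: ifPn => jS; case: ifPn => jT //; first by rewrite p0.
by rewrite (subsetP TS) in jS.
Qed.

Lemma nested_count_le S x : P x -> nested_count S <= \sum_(j in S) x 0 j.
Proof.
move=> [p [hp ->]]; rewrite sum_decomp // lerDl; apply: sumr_ge0 => T /andP[TB _].
by apply: sumr_ge0 => j _; have [] := simplex_coord (hp T TB).
Qed.

(** The excess over the minimum is a sum of nonnegative coordinates, so it vanishes iff each of them
    does. *)
Lemma facet_ofP (p : {set 'I_n.+1} -> 'rV[R]_n.+1) S :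
  (forall T, T \in B -> simplex_of T (p T)) ->
  facet_of S (\sum_(T in B) p T) <->
  (forall T, T \in B -> ~~ (T \subset S) -> forall j, j \in S -> p T 0 j = 0).
Proof.
move=> hp.
have p0 T j : T \in B -> 0 <= p T 0 j by move=> TB; have [] := simplex_coord (hp T TB).
split=> [[_]|h].
  rewrite sum_decomp // gerDl => le0 T TB TS j jS.
  have s0 : \sum_(T in B | ~~ (T \subset S)) \sum_(j in S) p T 0 j = 0.
    apply/eqP; rewrite eq_le le0 sumr_ge0 // => T' /andP[T'B _].
    by apply: sumr_ge0 => l _; exact: p0.
  have s1 : \sum_(j in S) p T 0 j = 0.
    move: s0 => /psumr_eq0P s0; apply: s0; last by rewrite TB.
    by move=> T' /andP[T'B _]; apply: sumr_ge0 => l _; exact: p0.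
  by move: s1 => /psumr_eq0P s1; apply: s1 => // l _; exact: p0.
split; first by exists p.
rewrite sum_decomp // big1 ?addr0 // => T /andP[TB TS]; apply: big1 => j jS.
exact: h.
Qed.

(** Points of P are produced by choosing one vertex in each summand; [Q] carries the constraints on
    the choice. *)
Lemma vertex_ex (Q : {set 'I_n.+1} -> 'I_n.+1 -> Prop) :
  (forall T, T \in B -> exists2 j, j \in T & Q T j) ->
  exists2 ch : {set 'I_n.+1} -> 'I_n.+1,
    (forall T, T \in B -> simplex_of T (delta_mx 0 (ch T) : 'rV[R]_n.+1)) &
    (forall T, T \in B -> Q T (ch T)).
Proof.
move=> h; have /fin_all_exists[ch chP] T : exists j, T \in B -> j \in T /\ Q T j.
  have [TB|_] := boolP (T \in B); last by exists ord0.
  by have [j jT Qj] := h T TB; exists j.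
by exists ch => T /chP[] // /simplex_vertex.
Qed.

Lemma facet_of_vertex (ch : {set 'I_n.+1} -> 'I_n.+1) S :
  (forall T, T \in B -> simplex_of T (delta_mx 0 (ch T) : 'rV[R]_n.+1)) ->
  facet_of S (\sum_(T in B) delta_mx 0 (ch T)) <->
  (forall T, T \in B -> ~~ (T \subset S) -> ch T \notin S).
Proof.
move=> hch; rewrite (facet_ofP _ hch); split=> h T TB TS.
  apply/negP => cS; have := h T TB TS _ cS; rewrite mxE !eqxx.
  by move/eqP; rewrite oner_eq0.
move=> j jS; rewrite mxE eqxx; case: eqP => // jc.
by have := h T TB TS; rewrite -jc jS.
Qed.

Lemma facet_of_nonempty S : exists x, facet_of S x.
Proof.
have [|ch hch Qch] := @vertex_ex (fun T j => ~~ (T \subset S) -> j \notin S).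
  move=> T TB; have [TS|/subsetPn[j jT jS]] := boolP (T \subset S); last by exists j.
  have /set0Pn[j jT] : T != set0 by move: TB; rewrite inE => /andP[].
  by exists j.
by exists (\sum_(T in B) delta_mx 0 (ch T)); apply/facet_of_vertex.
Qed.

Lemma facet_of_face S : is_face P (facet_of S).
Proof.
exists (\row_j - (j \in S)%:R).
have E y : \sum_j (\row_j - (j \in S)%:R : 'rV[R]_n.+1) 0 j * y 0 j =
    - \sum_(j in S) y 0 j.
  rewrite -sumrN [RHS]big_mkcond; apply: eq_bigr => j _; rewrite mxE mulNr.
  by case: (j \in S); rewrite ?mul1r ?mul0r ?oppr0.
move=> x; split=> [[Px xS]|[Px mx]]; split=> //.
  by move=> y Py; rewrite !E lerN2; apply: le_trans xS _; exact: nested_count_le.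
have [y [Py yS]] := facet_of_nonempty S.
by apply: le_trans yS; have := mx y Py; rewrite !E lerN2.
Qed.

Lemma facet_of_sub S S' : S' \in B -> S \in B -> S' != setT ->
  (forall x, facet_of S x -> facet_of S' x) -> S = S'.
Proof.
move=> S'B SB S'T h.
(* If V were in B, choosing j as its vertex would give a point of the face of S outside the face of
   S'. This is used for V = S and for V the full vertex set. *)
have sub (V : {set 'I_n.+1}) : ~~ (V \subset S') ->
    (exists2 j, j \in V :&: S' & (V \subset S) || (j \notin S)) -> V \notin B.
  move=> VS' [j /setIP[jV jS'] hj]; apply/negP => VB.
  have [|ch hch Qch] := @vertex_ex (fun T l =>
     (~~ (T \subset S) -> l \notin S) /\ (T = V -> l = j)).
    move=> T TB; have [->|TV] := eqVneq T V.
      by exists j => //; split=> // VS; move: hj; rewrite (negPf VS).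
    have [TS|/subsetPn[l lT lS]] := boolP (T \subset S); last first.
      by exists l => //; split=> // TV'; rewrite TV' eqxx in TV.
    have /set0Pn[l lT] : T != set0 by move: TB; rewrite inE => /andP[].
    by exists l => //; split=> // TV'; rewrite TV' eqxx in TV.
  have : facet_of S' (\sum_(T in B) delta_mx 0 (ch T)).
    by apply/h/facet_of_vertex => // T TB; have [] := Qch T TB.
  move/(facet_of_vertex _ hch) => /(_ V VB VS').
  by have [_ ->] := Qch V VB; rewrite // jS'.
apply/eqP; rewrite eqEsubset; apply/andP; split; apply: contraT => nsub.
  suff: S \notin B by rewrite SB.
  apply: (sub S nsub).
  have /set0Pn[j jSS'] : S :&: S' != set0; last by exists j; rewrite // subxx.
  apply: contraT; rewrite negbK => /eqP SS'0.
  have : setT \notin B; last by rewrite building_setT.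
  apply: (sub setT); first by rewrite subTset.
  have /set0Pn[j jS'] : S' != set0 by move: S'B; rewrite inE => /andP[].
  exists j; first by rewrite setTI.
  apply/orP; right; apply/negP => jS.
  by have := in_setI j S S'; rewrite SS'0 inE jS jS'.
have : setT \notin B; last by rewrite building_setT.
apply: (sub setT); first by rewrite subTset.
by case/subsetPn: nsub => j jS' jS; exists j; rewrite ?setTI // jS orbT.
Qed.

Lemma total_const x y : P x -> P y -> \sum_j x 0 j = \sum_j y 0 j.
Proof.
move=> [p [hp ->]] [p' [hp' ->]].
under eq_bigr => j _ do rewrite summxE.
under [RHS]eq_bigr => j _ do rewrite summxE.
rewrite exchange_big [RHS]exchange_big /=; apply: eq_bigr => T TB.
by rewrite (simplex_sum (hp T TB)) (simplex_sum (hp' T TB)).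
Qed.

Lemma facet_of_proper S : S \in B -> S != setT -> is_proper_face P (facet_of S).
Proof.
move=> SB ST; split; first exact: facet_of_face.
have /set0Pn[j jS] : S != set0 by move: SB; rewrite inE => /andP[].
have [|ch hch Qch] := @vertex_ex (fun T l => T = setT -> l = j).
  move=> T TB; have [->|TV] := eqVneq T setT; first by exists j; rewrite ?inE.
  have /set0Pn[l lT] : T != set0 by move: TB; rewrite inE => /andP[].
  by exists l => // T'; rewrite T' eqxx in TV.
move=> h; have : P (\sum_(T in B) delta_mx 0 (ch T)).
  by exists (fun T => delta_mx 0 (ch T)).
move/h/(facet_of_vertex _ hch)/(_ setT building_setT).
by rewrite subTset (Qch setT building_setT erefl) jS => /(_ ST).
Qed.

(** S is a connected component of the set L where c is not maximal. A summand T meeting S but not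
    inside it leaves L, so maximality of c forbids any weight of T on S. *)
Lemma proper_face_sub G : is_proper_face P G ->
  exists2 S, S \in B /\ S != setT & forall x, G x -> facet_of S x.
Proof.
move=> [[c Gc] GP].
pose j0 := [arg max_(j > ord0) c 0 j]%O.
have j0m j : c 0 j <= c 0 j0.
  by rewrite /j0; case: Order.TotalTheory.arg_maxP => // l _; apply.
pose L := [set j | c 0 j < c 0 j0].
(* If c is constant, the face is all of P, because the coordinate sum is constant on P. *)
have [L0|/set0Pn[l lL]] := eqVneq L set0.
  case: GP => x; rewrite Gc; split=> [[]//|Px]; split=> // y Py.
  have cE j : c 0 j = c 0 j0.
    apply/eqP; rewrite eq_le j0m leNgt; apply/negP => h.
    by have := in_set0 j; rewrite -L0 inE h.
  under eq_bigr => j _ do rewrite cE; under [leRHS]eq_bigr => j _ do rewrite cE.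
  by rewrite -!mulr_sumr (total_const Px Py).
have [S SB [SL Smax]] := building_set_component e lL.
exists S.
  split=> //; apply/eqP => ST; have := subsetP SL j0.
  by rewrite ST !inE ltxx => /(_ isT).
move=> x /Gc[[p [hp xE]] mx]; rewrite xE; apply/facet_ofP => // T TB TS j jS.
apply/eqP; apply: contraT => pj0.
have [_ ps0 psum] := simplex_coord (hp T TB).
have [pT0 _ _] := simplex_coord (hp T TB).
have jT : j \in T by apply: contraNT pj0 => /ps0 ->.
have /subsetPn[l' l'T l'L] : ~~ (T \subset L).
  apply: contra TS => TL; apply: Smax => //; apply/set0Pn; exists j; rewrite inE jT.
  exact: jS.
have cl' : c 0 l' = c 0 j0.
  by apply/eqP; rewrite eq_le j0m leNgt; move: l'L; rewrite inE.
(* The summand point for T is moved to a vertex where c is maximal; positive weight at j in L would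
   make this a strict increase. *)
pose p' U := if U == T then delta_mx 0 l' else p U : 'rV[R]_n.+1.
have hp' U : U \in B -> simplex_of U (p' U).
  by rewrite /p'; case: eqP => [->|_ /hp//]; move=> _; exact: simplex_vertex.
have := mx _ (ex_intro _ p' (conj hp' erefl)).
have lin (q : {set 'I_n.+1} -> 'rV[R]_n.+1) :
    \sum_j c 0 j * (\sum_(U in B) q U) 0 j = \sum_(U in B) \sum_j c 0 j * q U 0 j.
  by rewrite exchange_big; apply: eq_bigr => t _; rewrite summxE mulr_sumr.
rewrite xE !lin (bigD1 T TB) [leRHS](bigD1 T TB) /=.
rewrite [X in _ + X](eq_bigr (fun U => \sum_j c 0 j * p U 0 j)); last first.
  by move=> U /andP[_ /negPf UT]; rewrite /p' UT.
rewrite lerD2r /p' eqxx (bigD1 l') //= big1 => [|t tl]; last first.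
  by rewrite mxE eqxx (negPf tl) mulr0.
rewrite mxE !eqxx mulr1 addr0 cl' leNgt => /negP[].
rewrite -[ltRHS]mulr1 -(simplex_sum (hp T TB)) mulr_sumr.
rewrite (bigD1 j) //= [ltRHS](bigD1 j) //=; apply: ltr_leD.
  have cj : c 0 j < c 0 j0 by have := subsetP SL j jS; rewrite inE.
  have pj : 0 < p T 0 j by rewrite lt0r pj0 pT0.
  by rewrite (ltr_pM2r pj).
by apply: ler_sum => t _; apply: ler_wpM2r.
Qed.

Lemma facet_of_facet S : S \in B -> S != setT -> is_facet P (facet_of S).
Proof.
move=> SB ST; split; first exact: facet_of_proper.
move=> G' /proper_face_sub[S' [S'B S'T] G'S'] SG'.
have SS' : S = S' by apply: facet_of_sub => // x /SG'/G'S'.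
by move=> x; split=> [/SG'//|/G'S']; rewrite SS'.
Qed.

Lemma facet_ex G : is_facet P G ->
  exists2 S, S \in B /\ S != setT & same_set G (facet_of S).
Proof.
move=> [Gp Gm]; have [S [SB ST] GS] := proper_face_sub Gp.
by exists S => //; apply: Gm => //; exact: facet_of_proper.
Qed.

(** For incompatible S and S', a common point would force the summand of their union to have only
    zero coordinates, although they add up to 1. For compatible ones, [compatible_avoid] supplies
    the vertices. *)
Lemma facet_of_meet S S' : S \in B -> S' \in B ->
  (exists x, facet_of S x /\ facet_of S' x) <-> ~~ incompatible e S S'.
Proof.
move=> SB S'B; split=> [[x [[Px xS] [_ xS']]]|cSS'].
  apply/negP => iSS'; have [UB US US'] := incompatible_union SB S'B iSS'.
  have [p [hp xE]] := Px.
  have /(facet_ofP _ hp)/(_ _ UB US) h : facet_of S (\sum_(T in B) p T) by rewrite -xE.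
  have /(facet_ofP _ hp)/(_ _ UB US') h' : facet_of S' (\sum_(T in B) p T) by rewrite -xE.
  have [_ _] := simplex_coord (hp _ UB); rewrite big1 => [/esym/eqP|j].
    by rewrite oner_eq0.
  by case/setUP => [/h|/h'].
have [|ch hch Qch] := @vertex_ex (fun T j =>
   (~~ (T \subset S) -> j \notin S) /\ (~~ (T \subset S') -> j \notin S')).
  by move=> T TB; exact: (@compatible_avoid _ e).
exists (\sum_(T in B) delta_mx 0 (ch T)).
by split; apply/facet_of_vertex => // T TB; have [] := Qch T TB.
Qed.

Lemma facets_building m (F : 'I_m -> 'rV[R]_n.+1 -> Prop) : facets_of P F ->
  exists sg : 'I_m -> {set 'I_n.+1},
    [/\ injective sg, forall i, same_set (F i) (facet_of (sg i)),
        forall i, sg i \in B &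
        forall S, S \in B -> S != setT -> exists i, sg i = S].
Proof.
move=> [Ff Fs Fi]; have /fin_all_exists[sg sgP] (i : 'I_m) :
    exists S, (S \in B /\ S != setT) /\ same_set (F i) (facet_of S).
  by have [S h1 h2] := facet_ex (Ff i); exists S.
exists sg; split.
- move=> i j e'; apply: Fi => x; have [_ ->] := sgP i; have [_ ->] := sgP j.
  by rewrite e'.
- by move=> i; have [] := sgP i.
- by move=> i; have [[]] := sgP i.
move=> S SB ST; have [i Si] := Fs _ (facet_of_facet SB ST); exists i.
have [[iB iT] Fi'] := sgP i; apply: facet_of_sub => // x.
by rewrite -Fi' -Si.
Qed.

End Facets.

(** * The path *)

Section Path.
Variable N : nat.
Notation B := (building_set (@path_graph N)).
Notation inc := (incompatible (@path_graph N)).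

Definition itv (a b : nat) : {set 'I_N} := [set j : 'I_N | a <= j <= b].

Lemma itv_building a b : a <= b -> b < N -> itv a b \in B.
Proof.
move=> ab bN; have aN := leq_ltn_trans ab bN.
pose e := [rel u v : 'I_N | [&& u \in itv a b, v \in itv a b & path_graph u v]].
have es : connect_sym e.
  by apply: sym_connect_sym => u v; rewrite /= /path_graph /= andbCA;
    rewrite [(v.+1 == u) || _]orbC.
have h k (x : 'I_N) : x = a + k :> nat -> x <= b -> connect e (Ordinal aN) x.
  elim: k x => [|k IH] x xE xb.
    by rewrite (_ : x = Ordinal aN) ?connect0 //; apply/val_inj; rewrite /= xE addn0.
  have yN : a + k < N by have := ltn_ord x; lia.
  have yb : Ordinal yN <= b by rewrite /=; lia.
  apply: connect_trans (IH (Ordinal yN) erefl yb) _.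
  by apply: connect1; rewrite /= /path_graph !inE /=; lia.
have h' (x : 'I_N) : x \in itv a b -> connect e (Ordinal aN) x.
  by rewrite inE => /andP[ax xb]; apply: (h (x - a)) => //; rewrite subnKC.
rewrite inE; apply/andP; split.
  by apply/set0Pn; exists (Ordinal aN); rewrite inE /= leqnn.
apply/forall_inP => x /h' xa; apply/forall_inP => y /h' ya.
by apply: connect_trans ya; rewrite es.
Qed.

(** The ends are the least and greatest elements. A missing z between them would disconnect S, since
    no edge inside S passes from below z to above it. *)
Lemma building_itv S : S \in B -> exists a b, [/\ a <= b, b < N & S = itv a b].
Proof.
rewrite inE => /andP[/set0Pn[x0 x0S] /forall_inP cS].
case: (arg_minnP (fun j : 'I_N => j : nat) x0S) => a aS am.
case: (arg_maxnP (fun j : 'I_N => j : nat) x0S) => b bS bm.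
exists a, b; split; [exact: am|exact: ltn_ord|].
apply/setP => z; rewrite inE; apply/idP/idP => [zS|/andP[az zb]].
  by apply/andP; split; [exact: am|exact: bm].
apply: contraT => zS.
have /forall_inP/(_ b bS) cab := cS a aS.
have cl : closed [rel u v | [&& u \in S, v \in S & path_graph u v]]
    [pred u : 'I_N | u < z].
  move=> u v /= /and3P[uS vS]; rewrite /path_graph !inE /=.
  have uz : u != z :> nat by apply: contraNneq zS => /val_inj <-.
  have vz : v != z :> nat by apply: contraNneq zS => /val_inj <-.
  by lia.
have := closed_connect cl cab; rewrite !inE /=.
have : a != z :> nat by apply: contraNneq zS => /val_inj <-.
by lia.
Qed.

Lemma itv_inj a b c d : a <= b -> b < N -> c <= d -> d < N ->
  itv a b = itv c d -> a = c /\ b = d.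
Proof.
move=> ab bN cd dN /setP E.
have aN := leq_ltn_trans ab bN; have cN := leq_ltn_trans cd dN.
have := E (Ordinal aN); have := E (Ordinal bN).
have := E (Ordinal cN); have := E (Ordinal dN); rewrite !inE /=; lia.
Qed.

(** The shift by 2 turns a < c <= b + 1, which covers both overlap and adjacency, into a < c < b +
    2. For a <= b < N both arguments of [inord] are in range. *)
Definition diag (a b : nat) : 'I_N.+2 * 'I_N.+2 := (inord a, inord b.+2).

Lemma itv_subset a b c d : a <= b -> b < N ->
  (itv a b \subset itv c d) = (c <= a) && (b <= d).
Proof.
move=> ab bN; have aN := leq_ltn_trans ab bN; apply/subsetP/idP => [h|h x].
  have := h (Ordinal aN); have := h (Ordinal bN); rewrite !inE /= !leqnn ab /=.
  by move=> /(_ isT) /andP[_ ->] /(_ isT) /andP[-> _].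
by rewrite !inE; lia.
Qed.

Lemma itv_disjoint a b c d : a <= b -> b < N -> c <= d -> d < N ->
  (itv a b :&: itv c d == set0) = (b < c) || (d < a).
Proof.
move=> ab bN cd dN.
have aN := leq_ltn_trans ab bN; have cN := leq_ltn_trans cd dN.
apply/eqP/idP => [/setP E|h]; last by apply/setP => x; rewrite !inE; lia.
by have := E (Ordinal aN); have := E (Ordinal cN); rewrite !inE /=; lia.
Qed.

Lemma itv_union a b c d : a <= b -> b < N -> c <= d -> d < N ->
  (itv a b :|: itv c d \in B) = (c <= b.+1) && (a <= d.+1).
Proof.
move=> ab bN cd dN.
have aN := leq_ltn_trans ab bN; have cN := leq_ltn_trans cd dN.
apply/idP/idP => [/building_itv[a' [b' [_ _ /setP E]]]|h].
  have := E (Ordinal aN); have := E (Ordinal bN).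
  have := E (Ordinal cN); have := E (Ordinal dN); rewrite !inE /= => E1 E2 E3 E4.
  apply/andP; split; rewrite leqNgt; apply/negP => lt.
    have sN : b.+1 < N by lia.
    by have := E (Ordinal sN); rewrite !inE /=; lia.
  have sN : d.+1 < N by lia.
  by have := E (Ordinal sN); rewrite !inE /=; lia.
have -> : itv a b :|: itv c d = itv (minn a c) (maxn b d).
  by apply/setP => x; rewrite !inE; lia.
by apply: itv_building; lia.
Qed.

Lemma incompatible_itv a b c d : a <= b -> b < N -> c <= d -> d < N ->
  inc (itv a b) (itv c d) = cross (diag a b) (diag c d).
Proof.
move=> ab bN cd dN.
have -> : cross (diag a b) (diag c d) =
    [&& a < c, c <= b.+1 & b < d] || [&& c < a, a <= d.+1 & d < b].
  by rewrite /cross /diag /= !inordK; lia.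
have E1 : (itv a b :&: itv c d == itv a b) = (itv a b \subset itv c d).
  by apply/eqP/setIidPl.
have E2 : (itv a b :&: itv c d == itv c d) = (itv c d \subset itv a b).
  by apply/eqP/setIidPr.
have := itv_union ab bN cd dN; rewrite inE /incompatible => ->.
rewrite E1 E2 !itv_subset // itv_disjoint //; lia.
Qed.

Lemma diag_inj a b c d : a <= b -> b < N -> c <= d -> d < N ->
  diag a b = diag c d -> itv a b = itv c d.
Proof.
move=> ab bN cd dN [/(congr1 (@nat_of_ord _)) e1 /(congr1 (@nat_of_ord _)) e2].
by move: e1 e2; rewrite !inordK; try lia; move=> -> [->].
Qed.

Lemma i_max_ge : N./2 * (N - N./2) <= i_max (@path_graph N).
Proof.
have [h0|h0] := posnP N./2; first by rewrite h0.
have hN : N./2 < N by have := odd_double_half N; rewrite -addnn; lia.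
(* With h the half of N, the interval [0, h - 1] is incompatible with all [c, d] such that 1 <= c <=
   h <= d < N, and there are h (N - h) of them. *)
pose g := itv 0 (N./2).-1.
have gB : g \in B by apply: itv_building; lia.
apply: leq_trans (leq_bigmax_cond (F := i_of (@path_graph N)) g gB).
pose f (p : 'I_(N./2) * 'I_(N - N./2)) := itv p.1.+1 (N./2 + p.2).
rewrite -[X in X <= _](card_ord (N./2 * (N - N./2))).
have -> : #|'I_(N./2 * (N - N./2))| = #|{: 'I_(N./2) * 'I_(N - N./2)}|.
  by rewrite card_prod !card_ord.
have fle (p : 'I_(N./2) * 'I_(N - N./2)) : p.1.+1 <= N./2 + p.2 < N.
  by have := ltn_ord p.1; have := ltn_ord p.2; lia.
have fi : injective f.
  move=> p q; have /andP[p1 p2] := fle p; have /andP[q1 q2] := fle q.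
  move=> /(itv_inj p1 p2 q1 q2)[e1 e2].
  rewrite [p]surjective_pairing [q]surjective_pairing.
  by congr (_, _); apply/val_inj => /=; lia.
rewrite -(card_imset predT fi); apply/subset_leq_card/subsetP => _ /imsetP[p _ ->].
have /andP[p1 p2] := fle p; rewrite inE itv_building //=.
rewrite incompatible_itv //; try lia.
have := ltn_ord p.1; have := ltn_ord p.2.
by rewrite /cross /diag /= !inordK; lia.
Qed.

Lemma path_connected : 0 < N -> connected_subgraph (@path_graph N) setT.
Proof.
move=> N0; have <- : itv 0 N.-1 = setT.
  by apply/setP => x; rewrite !inE; have := ltn_ord x; lia.
have : itv 0 N.-1 \in B by apply: itv_building; lia.
by rewrite inE.
Qed.

End Path.

(** * Betti numbers of the associahedron *)

Lemma betti_linear_strand (k : idomainType) (m : nat) (K : {set 'I_m} -> Prop)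
    (cp : rel 'I_m) (X : graded_free_resolution (@SR_ideal k m K)) (i r : nat) :
  (forall J J' : {set 'I_m}, J' \subset J -> K J -> K J') ->
  (forall j, K [set j]) ->
  (forall j l, j != l -> K [set j; l] <-> cp j l) ->
  0 < i ->
  act_has_rank (@phi_act k m) (phi_cycle cp i) (phi_bound i) r ->
  bigraded_betti X i (2 * i.+1) r.
Proof.
case: i => // i Ksub K1 Kedge _ h; rewrite mul2n.
apply/tor_rank/zrank_chain; rewrite addn1.
exact: (strand_rank Ksub K1 Kedge) h.
Qed.

Lemma path_facet_incompatible (n m : nat) (sg : 'I_m -> {set 'I_n.+1}) :
  injective sg -> (forall i, sg i \in building_set (@path_graph n.+1)) ->
  let H := n.+1./2 * (n.+1 - n.+1./2) in
  let inc := fun i j => incompatible (@path_graph n.+1) (sg i) (sg j) in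
  forall J1 J2 : {set 'I_m}, J1 != set0 -> J2 != set0 ->
  (forall j l, j \in J1 -> l \in J2 -> inc j l) ->
  #|J1| + #|J2| <= H.+1 /\
  (#|J1| + #|J2| = H.+1 -> (#|J1| == 1) || (#|J2| == 1)).
Proof.
move=> sgi sgB H inc J1 J2 J10 J20 h.
have /fin_all_exists[ab abP] (i : 'I_m) : exists ab : nat * nat,
    [/\ ab.1 <= ab.2, ab.2 < n.+1 & sg i = itv n.+1 ab.1 ab.2].
  by have [a [b abP]] := building_itv (sgB i); exists (a, b).
pose dg i := diag n.+1 (ab i).1 (ab i).2.
have dgi : injective dg.
  move=> i j; have [i1 i2 iE] := abP i; have [j1 j2 jE] := abP j.
  by move=> /(diag_inj i1 i2 j1 j2); rewrite -iE -jE => /sgi.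
rewrite -(card_imset J1 dgi) -(card_imset J2 dgi).
apply: cross_bound.
- by have /set0Pn[j jJ] := J10; apply/set0Pn; exists (dg j); apply: imset_f.
- by have /set0Pn[j jJ] := J20; apply/set0Pn; exists (dg j); apply: imset_f.
move=> _ _ /imsetP[i iJ ->] /imsetP[j jJ ->].
have [i1 i2 iE] := abP i; have [j1 j2 jE] := abP j.
by rewrite -incompatible_itv // -iE -jE; exact: h.
Qed.

Theorem theorem3p3 (R : realType) (k : idomainType) (n m : nat)
    (F : 'I_m -> 'rV[R]_n.+1 -> Prop)
    (X : graded_free_resolution (@SR_ideal k m (nerve F))) :
  field_or_integers k ->
  3 <= n ->
  facets_of (@graph_associahedron R n.+1 (@path_graph n.+1)) F ->
  let imax := i_max (@path_graph n.+1) in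
  let s := #|special_subgraphs (@path_graph n.+1)| in
  (forall i : nat, imax < i -> bigraded_betti X i (2 * i.+1) 0) /\
  bigraded_betti X imax (2 * imax.+1) s.
Proof.
move=> _ n3 Ff imax s.
have conn : connected_subgraph (@path_graph n.+1) setT by exact: path_connected.
have [sg [sgi sgF sgB sgS]] := facets_building conn Ff.
pose inc : rel 'I_m := fun i j => incompatible (@path_graph n.+1) (sg i) (sg j).
have Himax : n.+1./2 * (n.+1 - n.+1./2) <= imax by exact: i_max_ge.
have imax2 : 2 < imax.
  (* Dimension at least 3 makes both halves of n + 1 at least 2, so [imax] is at least 4. *)
  apply: leq_trans Himax; have := odd_double_half n.+1; rewrite -addnn => e.
  have h2 : 2 <= n.+1./2 by lia.
  have h3 : 2 <= n.+1 - n.+1./2 by lia.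
  by apply: leq_trans (leq_mul h2 h3).
have bound : forall J1 J2 : {set 'I_m}, J1 != set0 -> J2 != set0 ->
  (forall j l, j \in J1 -> l \in J2 -> inc j l) ->
  #|J1| + #|J2| <= imax.+1 /\
  (#|J1| + #|J2| = imax.+1 -> (#|J1| == 1) || (#|J2| == 1)).
  move=> J1 J2 J10 J20 h.
  have [le eq1] := path_facet_incompatible sgi sgB J10 J20 h.
  split=> [|e]; first exact: leq_trans le _.
  (* A sum equal to [imax.+1] lies between the two bounds, which therefore coincide. *)
  by apply: eq1; apply/eqP; rewrite eqn_leq le e.
have inc_irr : irreflexive inc by move=> i; exact: incompatible_irr.
have inc_sym : ssrbool.symmetric inc by move=> i j; exact: incompatible_sym.
have Ksub (J J' : {set 'I_m}) : J' \subset J -> nerve F J -> nerve F J'.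
  by move=> /subsetP J'J [x xJ]; exists x => j /J'J /xJ.
have K1 j : nerve F [set j].
  have [x xj] := facet_of_nonempty R (@path_graph n.+1) (sg j).
  by exists x => l /set1P ->; apply/sgF.
have Kedge j l : j != l -> nerve F [set j; l] <-> ~~ inc j l.
  move=> _; split=> [[x xF]|/(facet_of_meet R (sgB j) (sgB l))[x [xj xl]]].
    apply/(facet_of_meet R (sgB j) (sgB l)); exists x.
    by split; apply/sgF/xF; rewrite !inE eqxx ?orbT.
  by exists x => t /set2P[] ->; apply/sgF.
have betti i r := betti_linear_strand (cp := fun j l => ~~ inc j l)
  (i := i) (r := r) X Ksub K1 Kedge.
(* The full vertex set belongs to the building set but gives no facet. Being incompatible with
   nothing, it is neither counted by any [i_of] nor special, so counts over facets agree with counts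
   over connected subgraphs. *)
have incT h : h \in building_set (@path_graph n.+1) ->
    incompatible (@path_graph n.+1) h setT = false.
  move=> hB; apply/negP => hi.
  have [_ _ /negP] := incompatible_union hB (building_setT conn) hi.
  by rewrite subsetT.
have cardT : i_of (@path_graph n.+1) setT = 0.
  apply: eq_card0 => h; rewrite inE; apply/negP => /andP[hB].
  by rewrite incompatible_sym incT.
have card_inc g : #|[set j | inc g j]| = i_of (@path_graph n.+1) (sg g).
  rewrite -(card_imset _ sgi); apply: eq_card => h; rewrite inE.
  apply/imsetP/andP => [[j]|[hB hi]]; first by rewrite inE => hi ->; split.
  have hT : h != setT.
    by apply: contraTneq hi => ->; rewrite incT.
  by have [j jE] := sgS h hB hT; exists j; rewrite ?inE /inc ?jE.
have sE : s = #|inc_special inc imax|.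
  rewrite -(card_imset _ sgi); apply: eq_card => h; rewrite inE.
  apply/andP/imsetP => [[hB hi]|[g]].
    have hT : h != setT.
      by apply: contraTneq hi => ->; rewrite cardT eq_sym -lt0n; apply: leq_trans imax2.
    have [g gE] := sgS h hB hT; exists g => //.
    by rewrite inE card_inc gE.
  by rewrite inE card_inc => hi ->.
split=> [i im|]; apply: betti.
- exact: leq_ltn_trans (leq0n _) im.
- exact: (phi_rank_gt k inc_sym bound im).
- exact: leq_trans _ imax2.
- exact: (phi_rank_eq k inc_irr inc_sym imax2 bound sE).
Qed.
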